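(* Let $F$ be a formal group over $\mathbb{C}$, let $\phi$ be an associate of $F$, and let $g\in x\mathbb{C}[[x]]$ with $g'(0)=1$. Set $$\hat{\phi}_{g}(x,z)=\phi(x,g(z)),$$ which is an associate of the formal group $F_{g}(x,y)=g^{-1}(F(g(x),g(y)))$. Let $(V,Y,\mathbf{1})$ be a nonlocal vertex $F$-algebra and let $W$ be a vector space equipped with a linear map $Y_{W}(\cdot,x):V\rightarrow (\mathrm{End}\,W)[[x,x^{-1}]]$. Then $(W,Y_{W})$ is a $\phi$-coordinated $V$-module (resp. $\phi$-coordinated quasi $V$-module) if and only if $(W,Y_{W})$ is a $\hat{\phi}_{g}$-coordinated module (resp. $\hat{\phi}_{g}$-coordinated quasi module) for the nonlocal vertex $F_{g}$-algebra $(V,Y_{g},\mathbf{1})$, where $Y_g(v,x)=Y(v,g(x))$ for $v\in V$.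
   Context: All vector spaces are over $\mathbb{C}$. A (one-dimensional) formal group over $\mathbb{C}$ is $F(x,y)\in\mathbb{C}[[x,y]]$ with $F(x,0)=x$, $F(0,y)=y$, $F(x,F(y,z))=F(F(x,y),z)$; it is automatically commutative. An associate of $F$ is $\phi(x,z)\in\mathbb{C}((x))[[z]]$ with $\phi(x,0)=x$ and $\phi(\phi(x,y),z)=\phi(x,F(y,z))$; powers $\phi(x,z)^m$, $m\in\mathbb{Z}$, are taken in $\mathbb{C}((x))[[z]]$. $g^{-1}$ is the compositional inverse of $g$. A nonlocal vertex $F$-algebra is a vector space $V$ with a linear map $Y(\cdot,x):V\to \mathrm{Hom}(V,V((x)))$, $v\mapsto Y(v,x)=\sum_{n\in\mathbb{Z}}v_nx^{-n-1}$, and a vector $\mathbf{1}\in V$ such that $Y(\mathbf{1},x)v=v$, $Y(v,x)\mathbf{1}\in V[[x]]$, $\lim_{x\to0}Y(v,x)\mathbf{1}=v$ for $v\in V$, and for $u,v,w\in V$ there exists a nonnegative integer $l$ such that $$F(x_0,x_2)^lY(u,F(x_0,x_2))Y(v,x_2)w=F(x_0,x_2)^lY(Y(u,x_0)v,x_2)w,$$ where in $Y(u,F(x_0,x_2))$ the powers $F(x_0,x_2)^m$ are expanded in $\mathbb{C}((x_0))[[x_2]]$. $Y(v,g(x))=\sum_n v_n\,g(x)^{-n-1}$ with $g(x)^m\in x^m\mathbb{C}[[x]]$. Let $V$ be a nonlocal vertex $F$-algebra and $\phi$ an associate of $F$. A $\phi$-coordinated quasi $V$-module is a vector space $W$ with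 a linear map $Y_W(\cdot,x):V\to\mathrm{Hom}(W,W((x)))\subset(\mathrm{End}\,W)[[x,x^{-1}]]$ such that $Y_W(\mathbf{1},x)=1_W$ and for $u,v\in V$ there exists $q(x_1,x_2)\in\mathbb{C}[[x_1,x_2]]$ such that $q(\phi(x_2,x_0),x_2)\neq0$, $$q(x_1,x_2)Y_W(u,x_1)Y_W(v,x_2)\in\mathrm{Hom}(W,W((x_1,x_2))),$$ $$\left(q(x_1,x_2)Y_W(u,x_1)Y_W(v,x_2)\right)|_{x_1=\phi(x_2,x_0)}=q(\phi(x_2,x_0),x_2)Y_W(Y(u,x_0)v,x_2).$$ A $\phi$-coordinated $V$-module is defined in the same way but with $q(x_1,x_2)$ required to be of the form $(x_1-x_2)^k$ with $k$ a nonnegative integer. Here $W((x_1,x_2))=W[[x_1,x_2]][x_1^{-1},x_2^{-1}]$. *)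

(* Defs.v *)
From HB Require Import structures.
From mathcomp Require Import all_boot all_order all_algebra.
From mathcomp Require Import zify.
From mathcomp Require Import boolp classical_sets functions cardinality fsbigop.

Set Implicit Arguments.
Unset Strict Implicit.
Unset Printing Implicit Defensive.

Import Order.TTheory GRing.Theory Num.Theory.
Local Open Scope classical_set_scope.
Local Open Scope ring_scope.

(* Every infinite sum below has finite support at the arguments for which it  *)
(* is meant, and [\sum_(i \in A)] is then the genuine sum (it is 0 when the   *)
(* support is infinite).                                                      *)

Section ClassicalInverse.
Variable A : comNzRingType.

Definition invertible : {pred A} := fun x => `[< exists y, y * x = 1 >].

Definition inverse (x : A) : A := xget x [set y | y * x = 1].

Lemma inverseVx : {in invertible, left_inverse 1 inverse *%R}.
Proof. by move=> x /asboolP ex; exact: (xgetPex x ex). Qed.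

Lemma invertiblePl (x y : A) : y * x = 1 -> invertible x.
Proof. by move=> yx1; apply/asboolP; exists y. Qed.

Lemma inverse_out : {in [predC invertible], inverse =1 id}.
Proof.
move=> x /negP nx; apply: xgetPN => y yx1.
by apply: nx; exact: (invertiblePl yx1).
Qed.

End ClassicalInverse.

(* {fps A} is A[[t]]; [f n] is the coefficient of t^n. *)
Record fps (A : Type) := Fps { fps_coef :> nat -> A }.

Notation "{ 'fps' A }" := (fps A) (at level 0, format "{ 'fps'  A }").

Lemma fpsP (A : Type) (f g : fps A) : f =1 g -> f = g.
Proof. by case: f g => [f] [g] /= /funext ->. Qed.

HB.instance Definition _ (A : Type) := gen_eqMixin (fps A).
HB.instance Definition _ (A : Type) := gen_choiceMixin (fps A).

Section FpsRing.
Variable A : comNzRingType.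
Implicit Types f g h : fps A.

Definition fps_add f g : fps A := Fps (fun n => f n + g n).
Definition fps_opp f : fps A := Fps (fun n => - f n).
Definition fps_mul f g : fps A := Fps (fun n => \sum_(i < n.+1) f i * g (n - i)%N).

Lemma fps_addA : associative fps_add.
Proof. by move=> f g h; apply: fpsP => n /=; rewrite addrA. Qed.
Lemma fps_addC : commutative fps_add.
Proof. by move=> f g; apply: fpsP => n /=; rewrite addrC. Qed.
Lemma fps_add0 : left_id (Fps (fun=> 0)) fps_add.
Proof. by move=> f; apply: fpsP => n /=; rewrite add0r. Qed.
Lemma fps_addN : left_inverse (Fps (fun=> 0)) fps_opp fps_add.
Proof. by move=> f; apply: fpsP => n /=; rewrite addNr. Qed.

HB.instance Definition _ :=
  GRing.isZmodule.Build (fps A) fps_addA fps_addC fps_add0 fps_addN.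

Definition fpsC (a : A) : fps A := Fps (fun n => if n == 0%N then a else 0).
Definition fpsX : fps A := Fps (fun n => (n == 1%N)%:R).

Let trunc N f : {poly A} := \poly_(i < N) f i.

Let coef_truncM N f g n : (n < N)%N ->
  (trunc N f * trunc N g)`_n = fps_mul f g n.
Proof.
move=> nN; rewrite coefM; apply: eq_bigr => i _.
have iN : (i < N)%N by apply: leq_trans nN; exact: ltn_ord.
have jN : (n - i < N)%N by apply: leq_ltn_trans nN; exact: leq_subr.
by rewrite !coef_poly iN jN.
Qed.

Lemma fps_mulC : commutative fps_mul.
Proof.
by move=> f g; apply: fpsP => n; rewrite -!(@coef_truncM n.+1) // mulrC.
Qed.

Lemma fps_mulA : associative fps_mul.
Proof.
move=> f g h; apply: fpsP => n.
have -> : fps_mul f (fps_mul g h) n =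
    (trunc n.+1 f * (trunc n.+1 g * trunc n.+1 h))`_n.
  rewrite coefM; apply: eq_bigr => i _.
  by rewrite coef_poly ltn_ord coef_truncM // ltnS leq_subr.
rewrite mulrA coefM; apply: eq_bigr => i _.
by rewrite coef_truncM ?ltn_ord // coef_poly ltnS leq_subr.
Qed.

Lemma fps_mul1 : left_id (fpsC 1) fps_mul.
Proof.
move=> f; apply: fpsP => n /=; rewrite big_ord_recl /= mul1r subn0.
by rewrite big1 ?addr0 // => i _; rewrite mul0r.
Qed.

Lemma fps_mulDl : left_distributive fps_mul fps_add.
Proof.
move=> f g h; apply: fpsP => n /=; rewrite -big_split /=.
by apply: eq_bigr => i _; rewrite mulrDl.
Qed.

Lemma fps_1neq0 : fpsC 1 != 0.
Proof.
apply/eqP => /(congr1 (fun f : fps A => f 0%N)) /= /eqP.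
by rewrite (negPf (oner_neq0 A)).
Qed.

HB.instance Definition _ := GRing.Zmodule_isComNzRing.Build (fps A)
  fps_mulA fps_mulC fps_mul1 fps_mulDl fps_1neq0.
HB.instance Definition _ := GRing.ComNzRing_hasMulInverse.Build (fps A)
  (@inverseVx (fps A)) (@invertiblePl (fps A)) (@inverse_out (fps A)).

(* f(h(t)); meant for h with zero constant term. *)
Definition fps_comp f h : fps A :=
  Fps (fun n => \sum_(j \in [set: nat]) f j * (h ^+ j) n).

Definition fps_compinv g : fps A :=
  xget 0 [set h : fps A | [/\ h 0%N = 0, fps_comp g h = fpsX & fps_comp h g = fpsX]].

End FpsRing.

Definition fps_map (A B : Type) (f : A -> B) (p : fps A) : fps B :=
  Fps (fun n => f (p n)).

Definition lower_truncated (M : nmodType) (f : int -> M) :=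
  exists N : int, forall n, n < N -> f n = 0.

(* {laurent A} is A((t)). *)
Record laurent (A : comNzRingType) := Laurent {
  laurent_coef :> int -> A;
  laurent_trunc : lower_truncated laurent_coef }.

Notation "{ 'laurent' A }" := (laurent A)
  (at level 0, format "{ 'laurent'  A }").

HB.instance Definition _ (A : comNzRingType) := gen_eqMixin (laurent A).
HB.instance Definition _ (A : comNzRingType) := gen_choiceMixin (laurent A).

Section LaurentRing.
Variable A : comNzRingType.
Implicit Types f g h : laurent A.

Lemma laurentP f g : f =1 g -> f = g.
Proof.
case: f g => [f fP] [g gP] /= /funext fg; case: _ / fg gP => gP.
by congr Laurent; exact: Prop_irrelevance.
Qed.

Fact laurent_add_subproof f g : lower_truncated (fun n => f n + g n).
Proof.
have [[N fN] [M gM]] := (laurent_trunc f, laurent_trunc g).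
by exists (Num.min N M) => n; rewrite lt_min => /andP[/fN -> /gM ->]; rewrite addr0.
Qed.
Definition laurent_add f g := Laurent (laurent_add_subproof f g).

Fact laurent_opp_subproof f : lower_truncated (fun n => - f n).
Proof. by have [N fN] := laurent_trunc f; exists N => n /fN ->; rewrite oppr0. Qed.
Definition laurent_opp f := Laurent (laurent_opp_subproof f).

(* t^N p(t) *)
Fact tpow_mul_subproof (N : int) (p : fps A) :
  lower_truncated (fun n : int => if N <= n then p `|(n - N)%R|%N else 0).
Proof. by exists N => n; rewrite ltNge => /negPf ->. Qed.
Definition tpow_mul N p := Laurent (tpow_mul_subproof N p).

Definition laurentC (a : A) := tpow_mul 0 (fpsC a).
Definition laurentX := tpow_mul 1 1.
Definition laurent_of_fps (p : fps A) := tpow_mul 0 p.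

Lemma laurent_addA : associative laurent_add.
Proof. by move=> f g h; apply: laurentP => n /=; rewrite addrA. Qed.
Lemma laurent_addC : commutative laurent_add.
Proof. by move=> f g; apply: laurentP => n /=; rewrite addrC. Qed.
Lemma laurent_add0 : left_id (laurentC 0) laurent_add.
Proof.
by move=> f; apply: laurentP => n /=; case: ifP; rewrite ?if_same add0r.
Qed.
Lemma laurent_addN : left_inverse (laurentC 0) laurent_opp laurent_add.
Proof.
by move=> f; apply: laurentP => n /=; case: ifP; rewrite ?if_same addNr.
Qed.

HB.instance Definition _ := GRing.isZmodule.Build (laurent A)
  laurent_addA laurent_addC laurent_add0 laurent_addN.

Fact laurent_mul_subproof f g :
  lower_truncated (fun n => \sum_(i \in [set: int]) f i * g (n - i)).
Proof.
have [[N fN] [M gM]] := (laurent_trunc f, laurent_trunc g).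
exists (N + M) => n nNM; apply: fsbig1 => i _.
have [/fN ->|Ni] := ltP i N; first by rewrite mul0r.
by rewrite gM ?mulr0 //; lia.
Qed.
Definition laurent_mul f g := Laurent (laurent_mul_subproof f g).

Lemma laurent_mul_tpow N M p q :
  laurent_mul (tpow_mul N p) (tpow_mul M q) = tpow_mul (N + M) (p * q).
Proof.
apply: laurentP => n /=; case: ifP => [leNMn|/negbT]; last first.
  rewrite -ltNge => ltnNM; apply: fsbig1 => i _.
  by case: ifP => [Ni|]; rewrite ?mul0r // ifF ?mulr0 //; lia.
set k := `|(n - (N + M))%R|%N.
have inj : set_inj `I_k.+1 (fun i : nat => N + i%:Z)%R by move=> i j _ _; lia.
rewrite -(@fsbig_widen _ _ _ _ ((fun i : nat => N + i%:Z)%R @` `I_k.+1)) //; last first.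
  move=> i /= [_ iP]; case: ifP => [Ni|]; last by rewrite mul0r.
  case: ifP => [Mi|]; last by rewrite mulr0.
  by case: iP; exists `|i - N|%N => /=; lia.
rewrite fsbig_image //= -(fsbig_ord _ _ (fun i : nat =>
  (if N <= N + i%:Z then p `|((N + i%:Z) - N)%R|%N else 0) *
  (if M <= n - (N + i%:Z) then q `|((n - (N + i%:Z)) - M)%R|%N else 0))%R).
apply: eq_bigr => i _; have ik := ltn_ord i.
rewrite !ifT; try lia.
by congr (p _ * q _); lia.
Qed.

Lemma laurent_tpowE f N : (forall n, n < N -> f n = 0) ->
  f = tpow_mul N (Fps (fun k => f (N + k%:Z))).
Proof.
move=> fN; apply: laurentP => n /=; case: ifP => [Nn|/negbT].
  by congr (f _); lia.
by rewrite -ltNge => /fN.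
Qed.

Lemma laurent_mulC : commutative laurent_mul.
Proof.
move=> f g; have [[N fN] [M gM]] := (laurent_trunc f, laurent_trunc g).
rewrite (laurent_tpowE fN) (laurent_tpowE gM) !laurent_mul_tpow.
by rewrite addrC mulrC.
Qed.

Lemma laurent_mulA : associative laurent_mul.
Proof.
move=> f g h; have [N fN] := laurent_trunc f.
have [[M gM] [L hL]] := (laurent_trunc g, laurent_trunc h).
rewrite (laurent_tpowE fN) (laurent_tpowE gM) (laurent_tpowE hL).
by rewrite !laurent_mul_tpow addrA mulrA.
Qed.

Lemma laurent_mul1 : left_id (laurentC 1) laurent_mul.
Proof.
move=> f; have [N fN] := laurent_trunc f.
by rewrite (laurent_tpowE fN) laurent_mul_tpow add0r (mul1r (_ : fps A)).
Qed.

Lemma laurent_mulDl : left_distributive laurent_mul laurent_add.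
Proof.
move=> f g h; have [L hL] := laurent_trunc h.
have [[N fN] [M gM]] := (laurent_trunc f, laurent_trunc g).
have fE : forall n, n < Num.min N M -> f n = 0 by move=> n; rewrite lt_min => /andP[/fN].
have gE : forall n, n < Num.min N M -> g n = 0 by move=> n; rewrite lt_min => /andP[_ /gM].
have tpowD K p q : laurent_add (tpow_mul K p) (tpow_mul K q) = tpow_mul K (p + q).
  by apply: laurentP => n /=; case: ifP; rewrite ?addr0.
rewrite (laurent_tpowE fE) (laurent_tpowE gE) (laurent_tpowE hL).
by rewrite tpowD !laurent_mul_tpow tpowD mulrDl.
Qed.

Lemma laurent_1neq0 : laurentC 1 != 0.
Proof.
apply/eqP => /(congr1 (fun f : laurent A => f 0)) /= /eqP.
by rewrite (negPf (oner_neq0 A)).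
Qed.

HB.instance Definition _ := GRing.Zmodule_isComNzRing.Build (laurent A)
  laurent_mulA laurent_mulC laurent_mul1 laurent_mulDl laurent_1neq0.
HB.instance Definition _ := GRing.ComNzRing_hasMulInverse.Build (laurent A)
  (@inverseVx (laurent A)) (@invertiblePl (laurent A))
  (@inverse_out (laurent A)).

End LaurentRing.

(* In iterated series types the outer index belongs to the last variable:     *)
(* for F in {fps {fps K}} = K[[x]][[y]] the coefficient of x^i y^j is F j i,  *)
(* and for f in {fps {laurent K}} = K((x))[[z]] that of x^n z^k is f k n.     *)

Section FormalGroups.
Variable K : comNzRingType.

Definition embed2 (F : {fps {fps K}}) : {fps {laurent K}} :=
  fps_map (@laurent_of_fps K) F.

(* The associativity field compares the coefficients of x^a y^b z^c in        *)
(* F(x, F(y, z)) and F(F(x, y), z).                                           *)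
Record formal_group (F : {fps {fps K}}) : Prop := {
  formal_groupx0 : F 0%N = fpsX K;
  formal_group0y : fps_map (fun p : {fps K} => p 0%N) F = fpsX K;
  formal_groupA : forall a b c : nat,
    \sum_(j \in [set: nat]) F j a * (F ^+ j) c b =
    \sum_(i \in [set: nat]) F c i * (F ^+ i) b a }.

(* The second field compares the coefficients of x^n y^j z^k in               *)
(* phi(phi(x, y), z) and phi(x, F(y, z)).                                     *)
Record associate (F : {fps {fps K}}) (phi : {fps {laurent K}}) : Prop := {
  associatex0 : phi 0%N = laurentX K;
  associateA : forall (n : int) (j k : nat),
    \sum_(m \in [set: int]) phi k m * (phi ^ m) j n =
    \sum_(l \in [set: nat]) phi l n * (F ^+ l) k j }.

(* F(g(x), g(y)) *)
Definition fg_subst2 (F : {fps {fps K}}) (g : {fps K}) : {fps {fps K}} :=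
  Fps (fun b => Fps (fun a =>
    \sum_(ij \in [set: nat * nat])
      F ij.2 ij.1 * ((g ^+ ij.1) a * (g ^+ ij.2) b))).

(* g^{-1}(F(g(x), g(y))) *)
Definition fg_twist (F : {fps {fps K}}) (g : {fps K}) : {fps {fps K}} :=
  Fps (fun b => Fps (fun a =>
    \sum_(l \in [set: nat]) fps_compinv g l * (fg_subst2 F g ^+ l) b a)).

(* phi(x, g(z)) *)
Definition associate_twist (phi : {fps {laurent K}}) (g : {fps K}) :
    {fps {laurent K}} :=
  fps_comp phi (fps_map (@laurentC K) g).

End FormalGroups.

(* Elements of M[[x^{+-1}, y^{+-1}]]: [s a b] is the coefficient of x^a y^b. *)
Definition series2 (M : Type) := int -> int -> M.

Section Series2.
Variables (K : comNzRingType) (M : lmodType K).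

Definition to_series2 (f : {fps {laurent K}}) : series2 K :=
  fun n k => if k is Posz j then f j n else 0.

Definition swap2 (T : Type) (s : series2 T) : series2 T := fun a b => s b a.

Definition mul2 (p : series2 K) (s : series2 M) : series2 M := fun a b =>
  \sum_(ij \in [set: int * int]) p ij.1 ij.2 *: s (a - ij.1) (b - ij.2).

(* The result in the variables (x0, x2) of substituting in s(x1, x2), for the *)
(* powers x1^m, the series pw m in (x0, x2).                                  *)
Definition subst_x1 (pw : int -> series2 K) (s : series2 M) : series2 M :=
  fun a b => \sum_(mn \in [set: int * int])
    pw mn.1 a (b - mn.2) *: s mn.1 mn.2.

Definition lower_truncated2 (s : series2 M) :=
  exists N : int, forall a b, (a < N) || (b < N) -> s a b = 0.

End Series2.

Section VertexAlgebras.
Variable K : comNzRingType.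

(* Y u w n is the coefficient of x^n (not of x^{-n-1}) in Y(u,x)w.            *)
Definition bilinear_modes (V W : lmodType K) (Y : V -> W -> int -> W) : Prop :=
  (forall w n, linear (fun u => Y u w n)) /\ (forall u n, linear (fun w => Y u w n)).

Definition const_series (M : nmodType) (v : M) : int -> M :=
  fun n => if n == 0 then v else 0.

(* F(x0,x2)^m in K((x0))[[x2]], as a series in (x0, x2) *)
Definition pow_fg (F : {fps {fps K}}) (m : int) : series2 K :=
  to_series2 (embed2 F ^ m).

(* phi(x2,x0)^m in K((x2))[[x0]], as a series in (x0, x2) *)
Definition pow_assoc (phi : {fps {laurent K}}) (m : int) : series2 K :=
  swap2 (to_series2 (phi ^ m)).

(* Y(u,x1)Y(v,x2)w as a series in (x1, x2) *)
Definition comp_modes (V W : lmodType K) (Y : V -> W -> int -> W)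
    (u v : V) (w : W) : series2 W :=
  fun m n => Y u (Y v w n) m.

(* YW(Y(u,x0)v,x2)w as a series in (x0, x2) *)
Definition iter_modes (V W : lmodType K) (Y : V -> V -> int -> V)
    (YW : V -> W -> int -> W) (u v : V) (w : W) : series2 W :=
  fun a b => YW (Y u v a) w b.

Record nonlocal_vertex_algebra (F : {fps {fps K}}) (V : lmodType K)
    (Y : V -> V -> int -> V) (one : V) : Prop := {
  nva_linear : bilinear_modes Y;
  nva_trunc : forall u v, lower_truncated (Y u v);
  nva_vacuum : forall v, Y one v = const_series v;
  nva_creation : forall v n, n < 0 -> Y v one n = 0;
  nva_creation0 : forall v, Y v one 0 = v;
  nva_assoc : forall u v w, exists l : nat,
    mul2 (pow_fg F l) (subst_x1 (pow_fg F) (comp_modes Y u v w)) =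
    mul2 (pow_fg F l) (iter_modes Y Y u v w) }.

(* Y(v, g(x)) *)
Definition vo_twist (V : lmodType K) (Y : V -> V -> int -> V) (g : {fps K}) :
    V -> V -> int -> V :=
  fun u v n => \sum_(m \in [set: int]) (laurent_of_fps g ^ m) n *: Y u v m.

(* q(x1,x2) as a series in (x1, x2) *)
Definition qseries (q : {fps {fps K}}) : series2 K := to_series2 (embed2 q).

(* q(phi(x2,x0),x2) as a series in (x0, x2) *)
Definition qsubst (phi : {fps {laurent K}}) (q : {fps {fps K}}) : series2 K :=
  subst_x1 (M := K^o) (pow_assoc phi) (qseries q).

(* The common part of the definitions of modules and quasi modules; Q is the  *)
(* class of series from which q is taken.                                     *)
Record coordinated_module_for (Q : set {fps {fps K}})
    (phi : {fps {laurent K}}) (V : lmodType K) (Y : V -> V -> int -> V)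
    (one : V) (W : lmodType K) (YW : V -> W -> int -> W) : Prop := {
  cm_linear : bilinear_modes YW;
  cm_trunc : forall v w, lower_truncated (YW v w);
  cm_vacuum : forall w, YW one w = const_series w;
  cm_assoc : forall u v, exists q, [/\ Q q,
    qsubst phi q <> (fun _ _ => 0),
    (forall w, lower_truncated2 (mul2 (qseries q) (comp_modes YW u v w))) &
    (forall w,
      subst_x1 (pow_assoc phi) (mul2 (qseries q) (comp_modes YW u v w)) =
      mul2 (qsubst phi q) (iter_modes Y YW u v w))] }.

(* In {fps {fps K}}, x1 is the constant series fpsC fpsX and x2 is fpsX. *)
Definition coordinated_module := coordinated_module_for
  [set q | exists k : nat, q = (fpsC (fpsX K) - fpsX {fps K}) ^+ k].

Definition coordinated_quasi_module := coordinated_module_for [set: {fps {fps K}}].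

End VertexAlgebras.

(* Main.v *)
(* Write G = F_g. Substitution is continuous, so a ring                      *)
(* homomorphism out of a power series ring is determined by the images of the *)
(* variables; comparing homomorphisms on the variables gives                  *)
(* g(G(x, y)) = F(g(x), g(y)) and transports associativity from F to G.       *)
(* The remaining assertions are changes of variables. Replacing x0 by g(x0)   *)
(* is injective on series bounded below in x0, since g(x)^m = x^m + ..., and  *)
(* it carries the identity defining phi-coordinated (quasi) modules to the    *)
(* one for phi(x, g(z)), with the same q. Replacing (x0, x2) by               *)
(* (g(x0), g(x2)) carries the associativity of Y relative to F to that of     *)
(* Y(v, g(x)) relative to G, with the factor g(G(x0, x2))^l; this is          *)
(* G(x0, x2)^l times an invertible power series, which can be divided out.    *)
Require Import Defs.
From HB Require Import structures.
From mathcomp Require Import all_boot all_order all_algebra.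
From mathcomp Require Import zify ring.
From mathcomp Require Import boolp classical_sets functions cardinality fsbigop.
From mathcomp Require Import reals.
From mathcomp Require Import complex.

Set Implicit Arguments.
Unset Strict Implicit.
Unset Printing Implicit Defensive.

Import Order.TTheory GRing.Theory Num.Theory.
Local Open Scope classical_set_scope.
Local Open Scope ring_scope.

(** * Finitely supported sums *)

(** Substituting g for a variable respects products, and each assertion transports a known identity
    along such a substitution.

    For F_g, both sides of each identity are values of ring homomorphisms. A homomorphism out of a
    power series ring that sends the variable to step 1 of a separated filtration is determined by
    its values on constants and on the variable ([fps_hom_ext]). Together with g(F_g(x, y)) =
    F(g(x), g(y)) ([fg_twist_subst]) this gives associativity of F_g ([fg_twistA]). The associate
    identity for phi(x, g(z)) follows by expanding in powers of g(y) and g(z) ([associate_twistP]).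

    For modules the substitution is x0 -> g(x0), written [subst_g1]. It sends phi(x2, x0)^m to the
    m-th power of phi(x2, g(x0)) and Y(u, x0) to Y_g(u, x0), and it is multiplicative
    ([subst_g1_mul2]); so it maps the module identity for phi to the one for the twisted associate,
    with the same q. Its matrix [gamma] is unitriangular, hence it is injective on series bounded
    below in x0 ([subst_g1_inj]), and the implication can be reversed. As q does not change, modules
    and quasi modules are both instances of [coordinated_module_twist].

    For the vertex algebra the substitution is (x0, x2) -> (g(x0), g(x2)), written [subst_g2]. It
    turns the substitution x1 = F(x0, x2) into x1 = F_g(x0, x2) applied to the substituted series
    ([subst_g2_fg]), and the resulting factor F(g(x0), g(x2))^l is replaced by F_g(x0, x2)^l by
    means of [fg_twist_dvd].

    A sum with infinite support is 0 by convention, so exchanging sums calls for a finite set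
    containing the support. These sets come from truncation of the modes and from bounds, valid for
    every integer m, on the poles of phi^m and F^m ([bounded_polesXz]). *)

Section FiniteSums.

Lemma finite_set_seq (I : choiceType) (A : set I) :
  finite_set A -> exists2 r : seq I, uniq r & forall i, A i -> i \in r.
Proof.
by move=> /finite_seqP[r ->]; exists (undup r) => [|i]; rewrite ?undup_uniq ?mem_undup.
Qed.

Lemma fsum_seq (I : choiceType) (M : nmodType) (r : seq I) (f : I -> M) :
  uniq r -> (forall i, f i != 0 -> i \in r) ->
  \sum_(i \in [set: I]) f i = \sum_(i <- r) f i.
Proof.
move=> ur rf; rewrite (fsbigE r) //; first by apply: eq_bigl => i; rewrite in_setT.
by move=> i _; apply: contraNeq; exact: rf.
Qed.

Lemma fsum_fubini (I J : choiceType) (M : nmodType) (f : I -> J -> M)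
    (A : set (I * J)) :
  finite_set A -> (forall i j, f i j != 0 -> A (i, j)) ->
  \sum_(p \in [set: I * J]) f p.1 p.2 =
  \sum_(i \in [set: I]) \sum_(j \in [set: J]) f i j.
Proof.
move=> finA fA.
have [r1 ur1 r1A] := finite_set_seq (finite_image fst finA).
have [r2 ur2 r2A] := finite_set_seq (finite_image snd finA).
have inner i : \sum_(j \in [set: J]) f i j = \sum_(j <- r2) f i j.
  by apply: fsum_seq => // j /fA Aij; apply: r2A; exists (i, j).
rewrite (@fsum_seq _ _ [seq (i, j) | i <- r1, j <- r2]); last 2 first.
- by apply: allpairs_uniq => // -[? ?] [? ?].
- move=> [i j] /fA Aij; apply/allpairsP; exists (i, j); split => //=.
    by apply: r1A; exists (i, j).
  by apply: r2A; exists (i, j).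
rewrite big_allpairs (@fsum_seq _ _ r1) //; last first.
  move=> i /fsbigN1[j _ /fA Aij].
  by apply: r1A; exists (i, j).
by apply: eq_bigr => i _; rewrite inner.
Qed.

Lemma fsum_exchange (I J : choiceType) (M : nmodType) (f : I -> J -> M)
    (A : set (I * J)) :
  finite_set A -> (forall i j, f i j != 0 -> A (i, j)) ->
  \sum_(i \in [set: I]) \sum_(j \in [set: J]) f i j =
  \sum_(j \in [set: J]) \sum_(i \in [set: I]) f i j.
Proof.
move=> finA fA; rewrite -(fsum_fubini finA fA).
pose swap (p : J * I) := (p.2, p.1).
have swapK : bijective swap by exists (fun p => (p.2, p.1)) => -[].
have finB : finite_set (swap @^-1` A).
  have -> : swap @^-1` A = (fun p => (p.2, p.1)) @` A.
    apply/seteqP; split => [[j i] /= h|[j i] /= [[i' j'] h [<- <-]] //].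
    by exists (i, j).
  exact: finite_image.
rewrite -(@fsum_fubini _ _ _ (fun j i => f i j) _ finB) //.
  by rewrite (reindex_fsbigT swap).
by move=> j i /fA.
Qed.

Lemma fsum_one (I : choiceType) (M : nmodType) (i0 : I) (f : I -> M) :
  (forall i, i != i0 -> f i = 0) -> \sum_(i \in [set: I]) f i = f i0.
Proof.
move=> f0; rewrite (@fsum_seq _ _ [:: i0]) ?big_seq1 // => i.
by rewrite inE; apply: contraNT => /f0 ->; rewrite eqxx.
Qed.

Lemma morph_fsum (I : choiceType) (M N : nmodType) (h : M -> N)
    (f : I -> M) (A : set I) :
  h 0 = 0 -> {morph h : x y / x + y} -> finite_set A -> (forall i, f i != 0 -> A i) ->
  h (\sum_(i \in [set: I]) f i) = \sum_(i \in [set: I]) h (f i).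
Proof.
move=> h0 hD /finite_set_seq[r ur rA] fA.
rewrite !(@fsum_seq _ _ r) ?(big_morph h hD h0) // => i; last by move=> /fA /rA.
by move=> hi; apply/rA/fA; apply: contraNneq hi => ->; rewrite h0.
Qed.

(** A map with trivial kernel preserves supports, so the formula also covers infinite supports,
    where both sums take the default value 0. *)
Lemma fsum_inj (I : choiceType) (M N : nmodType) (h : M -> N) (f : I -> M) :
  h 0 = 0 -> {morph h : x y / x + y} -> (forall x, h x = 0 -> x = 0) ->
  h (\sum_(i \in [set: I]) f i) = \sum_(i \in [set: I]) h (f i).
Proof.
move=> h00 hD h0.
have e : [set: I] `&` f @^-1` [set~ 0] = [set: I] `&` (h \o f) @^-1` [set~ 0].
  rewrite !setTI; apply/seteqP; split => i /= fi; first by move/h0.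
  by move=> fi0; apply: fi; rewrite fi0.
have [fin|inf] := pselect (finite_set ([set: I] `&` f @^-1` [set~ 0])).
  by rewrite (morph_fsum h00 hD fin) // => i /eqP ?; split.
by rewrite fsbig_dflt // h00 fsbig_dflt // -e.
Qed.

Lemma fsumD (I : choiceType) (M : nmodType) (f g : I -> M) (A : set I) :
  finite_set A -> (forall i, f i != 0 -> A i) -> (forall i, g i != 0 -> A i) ->
  \sum_(i \in [set: I]) (f i + g i) =
  \sum_(i \in [set: I]) f i + \sum_(i \in [set: I]) g i.
Proof.
move=> /finite_set_seq[r ur rA] fA gA.
rewrite !(@fsum_seq _ _ r) ?big_split //.
- by move=> i /gA /rA.
- by move=> i /fA /rA.
move=> i; have [-> | /fA /rA //] := eqVneq (f i) 0.
by rewrite add0r => /gA /rA.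
Qed.

Lemma eq_fsum (I : choiceType) (M : nmodType) (f g : I -> M) :
  f =1 g -> \sum_(i \in [set: I]) f i = \sum_(i \in [set: I]) g i.
Proof. by move=> fg; apply: eq_fsbigr => i _. Qed.

Lemma fsum_neq0 (I : choiceType) (M : nmodType) (f : I -> M) :
  \sum_(i \in [set: I]) f i != 0 -> exists i, f i != 0.
Proof.
move=> f0; apply: contrapT => nf; move/eqP: f0; apply; apply: fsbig1 => i _.
by apply: contrapT => /eqP fi; apply: nf; exists i.
Qed.

End FiniteSums.

Section FieldSums.
Variable K : fieldType.

(** A nonzero scalar acts injectively, so [fsum_inj] applies; the zero scalar makes both sides 0. *)
Lemma fsumZ (I : choiceType) (M : lmodType K) (c : K) (f : I -> M) :
  c *: \sum_(i \in [set: I]) f i = \sum_(i \in [set: I]) c *: f i.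
Proof.
have [->|c0] := eqVneq c 0.
  by rewrite scale0r fsbig1 // => i _; rewrite scale0r.
rewrite (@fsum_inj _ _ _ ( *:%R c)) ?scaler0 //; first exact: scalerDr.
move=> x /eqP; by rewrite scaler_eq0 (negPf c0) => /eqP.
Qed.

Lemma fsumZl (I : choiceType) (M : lmodType K) (v : M) (f : I -> K) :
  (\sum_(i \in [set: I]) f i) *: v = \sum_(i \in [set: I]) f i *: v.
Proof.
have [->|v0] := eqVneq v 0.
  by rewrite scaler0 fsbig1 // => i _; rewrite scaler0.
rewrite (@fsum_inj _ _ _ ( *:%R^~ v)) ?scale0r //; first by move=> x y; rewrite scalerDl.
move=> x /eqP; by rewrite scaler_eq0 (negPf v0) orbF => /eqP.
Qed.

Lemma fsumMr (I : choiceType) (c : K) (f : I -> K) :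
  c * \sum_(i \in [set: I]) f i = \sum_(i \in [set: I]) c * f i.
Proof. exact: (@fsumZ _ K^o). Qed.

Lemma fsumMl (I : choiceType) (c : K) (f : I -> K) :
  (\sum_(i \in [set: I]) f i) * c = \sum_(i \in [set: I]) f i * c.
Proof. exact: (@fsumZl _ K^o). Qed.

End FieldSums.

Lemma finite_int_range (a b : int) : finite_set [set n : int | a <= n <= b].
Proof.
apply: (@sub_finite_set _ _ ((fun i : nat => a + i%:Z) @` `I_(`|b - a|.+1))).
  by move=> n /= /andP[an nb]; exists `|n - a|%N; [lia|lia].
exact/finite_image/finite_II.
Qed.

(** * Homomorphisms out of power series rings *)

Definition to_rmorphism (A B : pzRingType) (f : A -> B)
    (fB : zmod_morphism f) (fM : monoid_morphism f) : {rmorphism A -> B} :=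
  HB.pack f (GRing.isZmodMorphism.Build A B f fB)
    (GRing.isMonoidMorphism.Build A B f fM).

Section FpsBasics.
Variable A : comNzRingType.
Implicit Types p q : {fps A}.

Lemma fps_coefM p q n : (p * q) n = \sum_(i < n.+1) p i * q (n - i)%N.
Proof. by []. Qed.

Lemma fps_coef_sum (I : Type) (r : seq I) (P : pred I) (F : I -> {fps A}) n :
  (\sum_(i <- r | P i) F i) n = \sum_(i <- r | P i) F i n.
Proof. by apply: (big_morph (fun p : {fps A} => p n)). Qed.

Fact fps_coef0_zmod : zmod_morphism (fun p : {fps A} => p 0%N).
Proof. by []. Qed.
Fact fps_coef0_monoid : monoid_morphism (fun p : {fps A} => p 0%N).
Proof. by split=> // p q; rewrite fps_coefM big_ord1. Qed.
Definition fps_coef0 := to_rmorphism fps_coef0_zmod fps_coef0_monoid.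

Fact fpsC_zmod : zmod_morphism (@fpsC A).
Proof. by move=> a b; apply: fpsP => -[|n] //=; rewrite subr0. Qed.
Lemma fps_coefCM a p n : (fpsC a * p) n = a * p n.
Proof.
by rewrite fps_coefM big_ord_recl subn0 big1 ?addr0 // => i _; rewrite mul0r.
Qed.
Fact fpsC_monoid : monoid_morphism (@fpsC A).
Proof.
by split=> // a b; apply: fpsP => n; rewrite fps_coefCM /=; case: n => //=; rewrite mulr0.
Qed.
HB.instance Definition _ := GRing.isZmodMorphism.Build _ _ _ fpsC_zmod.
HB.instance Definition _ := GRing.isMonoidMorphism.Build _ _ _ fpsC_monoid.

Lemma fps_coefXM p n : (fpsX A * p) n = if n is m.+1 then p m else 0.
Proof.
case: n => [|n]; first by rewrite fps_coefM big_ord1 /= mul0r.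
rewrite fps_coefM 2!big_ord_recl /= mul0r add0r mul1r subSS subn0.
by rewrite big1 ?addr0 // => i _; rewrite mul0r.
Qed.

Definition fps_shift p : {fps A} := Fps (fun n => p n.+1).

Lemma fps_shiftE p : p = fpsC (p 0%N) + fpsX A * fps_shift p.
Proof.
apply: fpsP => n; change (p n = fpsC (p 0%N) n + (fpsX A * fps_shift p) n).
by rewrite fps_coefXM; case: n => [|n] /=; rewrite ?addr0 ?add0r.
Qed.

End FpsBasics.

Lemma fps_map_coef (A B : Type) (f : A -> B) (p : {fps A}) n :
  fps_map f p n = f (p n).
Proof. by []. Qed.

Section FpsMap.
Variables (A B : comNzRingType) (f : {rmorphism A -> B}).

Fact fps_map_zmod : zmod_morphism (fps_map f).
Proof. by move=> p q; apply: fpsP => n /=; rewrite rmorphB. Qed.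
Fact fps_map_monoid : monoid_morphism (fps_map f).
Proof.
split=> [|p q].
  by apply: fpsP => -[|n] /=; rewrite ?rmorph1 ?rmorph0.
apply: fpsP => n; rewrite fps_coefM /= rmorph_sum.
by apply: eq_bigr => i _; rewrite rmorphM.
Qed.
HB.instance Definition _ := GRing.isZmodMorphism.Build _ _ _ fps_map_zmod.
HB.instance Definition _ := GRing.isMonoidMorphism.Build _ _ _ fps_map_monoid.

Lemma fps_mapC a : fps_map f (fpsC a) = fpsC (f a).
Proof. by apply: fpsP => n /=; case: eqP => // _; rewrite rmorph0. Qed.

Lemma fps_mapX : fps_map f (fpsX A) = fpsX B.
Proof. by apply: fpsP => n /=; rewrite rmorph_nat. Qed.

End FpsMap.

(** An algebraic substitute for an adic topology. By [fil0] and [filM] every step is stable under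
    multiplication by the ring, and [fil_sep] reduces an equality to congruences modulo all
    steps. *)
Record filtration (A : comNzRingType) := Filtration {
  fil :> nat -> A -> Prop;
  fil0 : forall a, fil 0 a;
  filS : forall n a, fil n.+1 a -> fil n a;
  filz : forall n, fil n 0;
  filD : forall n a b, fil n a -> fil n b -> fil n (a + b);
  filM : forall m n a b, fil m a -> fil n b -> fil (m + n) (a * b);
  fil_sep : forall a, (forall n, fil n a) -> a = 0 }.

Section Filtrations.
Variables (A : comNzRingType) (v : filtration A).

Lemma fil_le m n a : (m <= n)%N -> v n a -> v m a.
Proof.
move=> /subnK <-; elim: (n - m)%N => [|k IH] //.
by rewrite addSn => /filS /IH.
Qed.

Lemma filMl n a b : v n b -> v n (a * b).
Proof. by move=> vb; rewrite -[n]add0n; apply: filM => //; exact: fil0. Qed.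

Lemma filN n a : v n a -> v n (- a).
Proof. by move=> va; rewrite -mulN1r; exact: filMl. Qed.

Lemma filB n a b : v n a -> v n b -> v n (a - b).
Proof. by move=> va vb; apply: filD => //; exact: filN. Qed.

Lemma fil_sum n (I : Type) (r : seq I) (P : pred I) (F : I -> A) :
  (forall i, P i -> v n (F i)) -> v n (\sum_(i <- r | P i) F i).
Proof.
by move=> vF; apply: (big_ind (v n)) => //; [exact: filz|exact: filD].
Qed.

Lemma filX n a : v 1%N a -> v n (a ^+ n).
Proof.
move=> va; elim: n => [|n IH]; first exact: fil0.
by rewrite exprS -add1n; exact: filM.
Qed.

(** The variable has weight 1: the coefficient of t^i has to lie in step n - i only, which is no
    condition for i >= n because the subtraction is truncated. Iterating the construction gives the
    filtration by total degree in several variables. *)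
Definition fps_fil_def n (p : {fps A}) := forall i, v (n - i)%N (p i).

Definition fps_fil : filtration {fps A}.
Proof.
exists fps_fil_def.
- by move=> p i; rewrite sub0n; exact: fil0.
- by move=> n p vp i; apply: fil_le (vp i); lia.
- by move=> n i; exact: filz.
- by move=> n p q vp vq i; apply: filD; [exact: vp|exact: vq].
- move=> m n p q vp vq k; rewrite fps_coefM; apply: fil_sum => i _.
  by apply: fil_le (filM (vp i) (vq (k - i)%N)); have := ltn_ord i; lia.
- move=> p vp; apply: fpsP => i; apply: (@fil_sep _ v) => n.
  by have := vp (n + i)%N i; rewrite addnK.
Defined.

End Filtrations.

(** The discrete filtration, the base of the iteration: [fps_fil (triv_fil A)] is the t-adic
    filtration of A[[t]]. *)
Definition triv_fil (A : comNzRingType) : filtration A.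
Proof.
exists (fun n (a : A) => n = 0%N \/ a = 0).
- by move=> a; left.
- by move=> n a [//|->]; right.
- by move=> n; right.
- by move=> n a b [->|->] [b0|->]; [left|left|left|right; rewrite addr0].
- move=> m n a b [->|->] [->|->]; [by left| | |]; right.
  + by rewrite mulr0.
  + by rewrite mul0r.
  by rewrite mul0r.
- by move=> a /(_ 1%N) [].
Defined.

Section HomExt.
Variables (A B : comNzRingType) (v : filtration B).

(** Write p as its constant term plus t times its shift. Then f - g at p equals f(t) times f - g at
    the shift, so n repetitions put the difference into step n. *)
Lemma fps_hom_ext (f g : {rmorphism {fps A} -> B}) :
  (forall a, f (fpsC a) = g (fpsC a)) -> f (fpsX A) = g (fpsX A) ->
  v 1%N (f (fpsX A)) -> f =1 g.
Proof.
move=> fgC fgX vX p; apply/subr0_eq; apply: (@fil_sep _ v) => n.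
elim: n p => [|n IH] p; first exact: fil0.
rewrite [p]fps_shiftE !rmorphD !rmorphM /= fgC -fgX.
rewrite opprD addrACA subrr add0r -mulrBr -add1n.
by apply: filM.
Qed.

(* Modulo v n, evaluation at T agrees with the evaluation of the truncated    *)
(* polynomials, which is multiplicative.                                      *)
Variables (iota : {rmorphism A -> B}) (T : B) (ev : {fps A} -> B).
Hypothesis vT : v 1%N T.
Hypothesis evP : forall p n, v n (ev p - \sum_(k < n) iota (p k) * T ^+ k).

Let s n (p : {fps A}) := \sum_(k < n) iota (p k) * T ^+ k.
Let tr n (p : {fps A}) : {poly A} := \poly_(k < n) p k.

Let sE n p : s n p = (map_poly iota (tr n p)).[T].
Proof.
rewrite (@horner_coef_wide _ n); last first.
  by rewrite (leq_trans (size_poly _ _)) // (leq_trans (size_poly _ _)).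
by apply: eq_bigr => i _; rewrite coef_map coef_poly ltn_ord.
Qed.

Let vhorner n (r : {poly A}) : (forall i, (i < n)%N -> r`_i = 0) ->
  v n (map_poly iota r).[T].
Proof.
move=> r0; rewrite horner_coef; apply: fil_sum => i _.
rewrite coef_map /=; have [/r0 ->|ni] := ltnP i n; first by rewrite rmorph0 mul0r; exact: filz.
by apply: filMl; apply: fil_le ni _; exact: filX.
Qed.

Let sM n p q : v n (s n (p * q) - s n p * s n q).
Proof.
rewrite !sE -hornerM -rmorphM -hornerN -hornerD -rmorphB /=.
apply: vhorner => i ni; rewrite coefB coefM coef_poly ni fps_coefM.
apply/eqP; rewrite subr_eq0; apply/eqP/eq_bigr => j _.
by rewrite !coef_poly !ifT //; have := ltn_ord j; lia.
Qed.

Lemma ev_zmod : zmod_morphism ev.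
Proof.
move=> p q; apply/subr0_eq; apply: (@fil_sep _ v) => n.
have -> : ev (p - q) - (ev p - ev q) =
    (ev (p - q) - s n (p - q)) - (ev p - s n p) + (ev q - s n q).
  have -> : s n (p - q) = s n p - s n q.
    by rewrite /s -sumrB; apply: eq_bigr => i _; rewrite rmorphB mulrBl.
  by ring.
by apply: filD; [apply: filB|]; exact: evP.
Qed.

Lemma evC a : ev (fpsC a) = iota a.
Proof.
apply/subr0_eq; apply: (@fil_sep _ v) => n; apply: filS.
have := evP (fpsC a) n.+1; rewrite big_ord_recl big1 ?addr0 /= ?mulr1 //.
by move=> i _; rewrite rmorph0 mul0r.
Qed.

Lemma evX : ev (fpsX A) = T.
Proof.
apply/subr0_eq; apply: (@fil_sep _ v) => n; apply/filS/filS.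
have := evP (fpsX A) n.+2; rewrite 2!big_ord_recl big1 ?addr0 /=.
  by rewrite rmorph0 mul0r add0r rmorph1 mul1r expr1.
by move=> i _; rewrite rmorph0 mul0r.
Qed.

Lemma ev_monoid : monoid_morphism ev.
Proof.
split=> [|p q]; first by rewrite evC rmorph1.
apply/subr0_eq; apply: (@fil_sep _ v) => n.
have -> : ev (p * q) - ev p * ev q =
    (ev (p * q) - s n (p * q)) + (s n (p * q) - s n p * s n q)
    - ev q * (ev p - s n p) - s n p * (ev q - s n q) by ring.
apply: filB; last by apply: filMl; exact: evP.
apply: filB; last by apply: filMl; exact: evP.
by apply: filD; [exact: evP|exact: sM].
Qed.

Definition ev_rmorphism := to_rmorphism ev_zmod ev_monoid.

End HomExt.

(** * Composition, compositional inverses and units of power series *)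

Arguments fps_comp : simpl never.

Section Composition.
Variable A : comNzRingType.
Implicit Types p g h : {fps A}.

Lemma fps_vanish0 g : g 0%N = 0 -> fps_fil (triv_fil A) 1%N g.
Proof. by move=> g0 [|i]; [right|left]. Qed.

Lemma fps_coefX_lt g j i : g 0%N = 0 -> (i < j)%N -> (g ^+ j) i = 0.
Proof.
move=> g0 ij; have /(_ i)[|//] := filX j (fps_vanish0 g0).
by move=> /eqP; rewrite subn_eq0 leqNgt ij.
Qed.

Lemma fps_compE p g n N : g 0%N = 0 -> (n < N)%N ->
  fps_comp p g n = \sum_(j < N) p j * (g ^+ j) n.
Proof.
move=> g0 nN; rewrite [LHS](@fsum_seq _ _ (iota 0 N)) ?iota_uniq //; last first.
  move=> j; rewrite mem_iota add0n /=; apply: contraNT; rewrite -leqNgt => Nj.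
  by rewrite fps_coefX_lt ?mulr0 //; exact: leq_trans nN _.
by rewrite -(big_mkord xpredT (fun j => p j * (g ^+ j) n)) /index_iota subn0.
Qed.

Lemma fps_comp_trunc g (g0 : g 0%N = 0) p n :
  fps_fil (triv_fil A) n (fps_comp p g - \sum_(k < n) fpsC (p k) * g ^+ k).
Proof.
move=> i; have [ni|ni] := leqP n i; first by left; apply/eqP; rewrite subn_eq0.
right; change (fps_comp p g i - (\sum_(k < n) fpsC (p k) * g ^+ k) i = 0).
rewrite (@fps_compE _ _ _ n) // fps_coef_sum.
by apply/eqP; rewrite subr_eq0; apply/eqP/eq_bigr => k _; rewrite fps_coefCM.
Qed.

Definition fps_comp_rmorphism g (g0 : g 0%N = 0) : {rmorphism {fps A} -> {fps A}} :=
  ev_rmorphism (fps_vanish0 g0) (fps_comp_trunc g0).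

Lemma fps_comp_rmorphismE g (g0 : g 0%N = 0) p :
  fps_comp_rmorphism g0 p = fps_comp p g.
Proof. by []. Qed.

Lemma fps_compC g a : g 0%N = 0 -> fps_comp (fpsC a) g = fpsC a.
Proof. move=> g0; exact: (evC (fps_comp_trunc g0)). Qed.

Lemma fps_compX g : g 0%N = 0 -> fps_comp (fpsX A) g = g.
Proof. by move=> g0; exact: (evX (fps_comp_trunc g0)). Qed.

Lemma fps_comp_coef0 g p : g 0%N = 0 -> fps_comp p g 0%N = p 0%N.
Proof. by move=> g0; rewrite (@fps_compE _ _ _ 1) // big_ord1 expr0 mulr1. Qed.

Lemma fps_compA p g h : g 0%N = 0 -> h 0%N = 0 ->
  fps_comp (fps_comp p g) h = fps_comp p (fps_comp g h).
Proof.
move=> g0 h0; have gh0 : fps_comp g h 0%N = 0 by rewrite fps_comp_coef0.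
apply: (@fps_hom_ext _ _ (fps_fil (triv_fil A)) (fps_comp_rmorphism h0 \o fps_comp_rmorphism g0)
  (fps_comp_rmorphism gh0)).
- by move=> a; rewrite /= !fps_compC.
- by rewrite /= !fps_compX.
- by apply: fps_vanish0; rewrite [LHS](fps_comp_coef0 (fps_comp (fpsX A) g)) ?fps_comp_coef0.
Qed.

Lemma fps_comp_idr p : fps_comp p (fpsX A) = p.
Proof.
have X0 : fpsX A 0%N = 0 by [].
apply: (@fps_hom_ext _ _ (fps_fil (triv_fil A)) (fps_comp_rmorphism X0) idfun).
- by move=> a; rewrite /= fps_compC.
- by rewrite /= fps_compX.
- by apply: fps_vanish0; rewrite [LHS](fps_comp_coef0 (fpsX A)).
Qed.

Lemma fps_coefXn_diag g n : g 0%N = 0 -> (g ^+ n) n = g 1%N ^+ n.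
Proof.
move=> g0; have gE : g = fpsX A * fps_shift g.
  by rewrite [LHS]fps_shiftE g0 rmorph0 add0r.
rewrite {1}gE exprMn.
have XnM k (q : {fps A}) : (fpsX A ^+ k * q) k = q 0%N.
  elim: k => [|k IH]; first by rewrite expr0 mul1r.
  by rewrite exprS -mulrA fps_coefXM.
rewrite XnM; exact: (rmorphXn (fps_coef0 A)).
Qed.

(** Since g^n = t^n + ..., the coefficient of t^n in h(g(t)) is h_n plus an expression in the
    earlier h_j, so h can be solved for recursively. *)
Lemma fps_left_compinv g : g 0%N = 0 -> g 1%N = 1 ->
  exists h, [/\ h 0%N = 0, h 1%N = 1 & fps_comp h g = fpsX A].
Proof.
move=> g0 g1.
(* [hs n] lists h_0, ..., h_(n-1), and [next] is the following coefficient, chosen so that h(g(t))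
   agrees with t in that degree. *)
pose next (s : seq A) : A := (size s == 1%N)%:R -
  \sum_(j < size s) s`_j * (g ^+ j) (size s).
pose hs := fix hs n := if n is m.+1 then rcons (hs m) (next (hs m)) else [::].
have size_hs n : size (hs n) = n by elim: n => //= n IH; rewrite size_rcons IH.
have nth_hs n j : (j < n)%N -> (hs n)`_j = (hs j.+1)`_j.
  elim: n => // n IH; rewrite ltnS leq_eqVlt => /predU1P[-> //|jn].
  by rewrite /= [LHS]nth_rcons size_hs jn IH.
pose h := Fps (fun n => (hs n.+1)`_n).
have hE n : h n = (n == 1%N)%:R - \sum_(j < n) h j * (g ^+ j) n.
  rewrite /= nth_rcons size_hs ltnn eqxx /next size_hs; congr (_ - _).
  by apply: eq_bigr => j _; rewrite nth_hs.
have h0 : h 0%N = 0 by rewrite hE big_ord0 subr0.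
exists h; split => //.
  by rewrite hE big_ord1 h0 mul0r subr0.
apply: fpsP => n; rewrite (@fps_compE _ _ _ n.+1) // big_ord_recr /=.
rewrite fps_coefXn_diag // g1 expr1n mulr1 -[(rcons _ _)`_n]/(h n) hE.
by rewrite addrC subrK.
Qed.

(** A left inverse h of g has a left inverse k itself, and g = (k o h) o g = k o (h o g) = k; so h
    is inverse to g on both sides. *)
Lemma fps_compinvP g : g 0%N = 0 -> g 1%N = 1 ->
  [/\ fps_compinv g 0%N = 0, fps_comp g (fps_compinv g) = fpsX A &
      fps_comp (fps_compinv g) g = fpsX A].
Proof.
move=> g0 g1; apply: (@xgetPex _ 0 [set h : {fps A} |
  [/\ h 0%N = 0, fps_comp g h = fpsX A & fps_comp h g = fpsX A]]).
have [h [h0 h1 hg]] := fps_left_compinv g0 g1.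
have [k [k0 k1 kh]] := fps_left_compinv h0 h1.
exists h; split => //.
suff -> : g = k by [].
by rewrite -[g]fps_compX // -kh fps_compA // hg fps_comp_idr.
Qed.

(** Here y p = 1 - w with w free of constant term, and substituting w into the geometric series
    inverts 1 - w. *)
Lemma fps_unit p y : y * p 0%N = 1 -> p \is a GRing.unit.
Proof.
move=> yp; pose w : {fps A} := 1 - fpsC y * p.
have w0 : w 0%N = 0.
  by change (1 - (fpsC y * p) 0%N = 0); rewrite fps_coefCM yp subrr.
pose G : {fps A} := Fps (fun=> 1).
have GE : (1 - fpsX A) * G = 1.
  apply: fpsP => n; rewrite mulrBl mul1r.
  change (G n - (fpsX A * G) n = (1 : {fps A}) n).
  by rewrite fps_coefXM; case: n => [|n] /=; rewrite ?subr0 ?subrr.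
have := congr1 (fps_comp_rmorphism w0) GE.
rewrite rmorphM rmorphB rmorph1 /= fps_compX // subKr => e.
apply: (@invertiblePl {fps A} p (fps_comp G w * fpsC y)).
by rewrite -e; ring.
Qed.

End Composition.

(** * Substitution in two variables and twisted formal groups *)

Section Subst2.
Variable A : comNzRingType.
Implicit Types (p q : {fps A}) (P Q : {fps {fps A}}).

Definition fps_subst2 P p : {fps {fps A}} :=
  Fps (fun b => Fps (fun a => \sum_(l \in [set: nat]) p l * (P ^+ l) b a)).

Definition fil2 := fps_fil (fps_fil (triv_fil A)).

Lemma fps2_vanish0 P : P 0%N 0%N = 0 -> fil2 1%N P.
Proof. by move=> P0 [|b] [|a]; [right|left|left|left]. Qed.

Lemma fps2_coefX_lt P l b a : P 0%N 0%N = 0 -> (b + a < l)%N -> (P ^+ l) b a = 0.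
Proof.
move=> P0 bal; have /(_ b a)[|//] := filX l (fps2_vanish0 P0).
by move=> /eqP; rewrite -subnDA subn_eq0 leqNgt bal.
Qed.

Lemma fps_subst2E P p b a N : P 0%N 0%N = 0 -> (b + a < N)%N ->
  fps_subst2 P p b a = \sum_(l < N) p l * (P ^+ l) b a.
Proof.
move=> P0 baN; rewrite [LHS](@fsum_seq _ _ (iota 0 N)) ?iota_uniq //; last first.
  move=> l; rewrite mem_iota add0n /=; apply: contraNT; rewrite -leqNgt => Nl.
  by rewrite fps2_coefX_lt ?mulr0 //; exact: leq_trans baN _.
by rewrite -(big_mkord xpredT (fun l => p l * (P ^+ l) b a)) /index_iota subn0.
Qed.

Lemma fps_subst2_trunc P (P0 : P 0%N 0%N = 0) p n :
  fil2 n (fps_subst2 P p - \sum_(k < n) fpsC (fpsC (p k)) * P ^+ k).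
Proof.
move=> b a; have [nba|ban] := leqP n (b + a).
  by left; apply/eqP; rewrite -subnDA subn_eq0.
right; change (fps_subst2 P p b a - (\sum_(k < n) fpsC (fpsC (p k)) * P ^+ k) b a = 0).
rewrite (@fps_subst2E _ _ _ _ n) // !fps_coef_sum.
by apply/eqP; rewrite subr_eq0; apply/eqP/eq_bigr => k _; rewrite !fps_coefCM.
Qed.

Definition fps_subst2_rmorphism P (P0 : P 0%N 0%N = 0) :
    {rmorphism {fps A} -> {fps {fps A}}} :=
  @ev_rmorphism _ _ fil2 (@fpsC {fps A} \o @fpsC A) _ _ (fps2_vanish0 P0)
    (fps_subst2_trunc P0).

Lemma fps_subst2C P a : P 0%N 0%N = 0 -> fps_subst2 P (fpsC a) = fpsC (fpsC a).
Proof.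
by move=> P0; exact: (@evC _ _ fil2 (@fpsC {fps A} \o @fpsC A) _ _ (fps_subst2_trunc P0)).
Qed.

Lemma fps_subst2X P : P 0%N 0%N = 0 -> fps_subst2 P (fpsX A) = P.
Proof.
by move=> P0; exact: (@evX _ _ fil2 (@fpsC {fps A} \o @fpsC A) _ _ (fps_subst2_trunc P0)).
Qed.

Lemma fps_subst2Xn P p n : P 0%N 0%N = 0 ->
  fps_subst2 P (p ^+ n) = fps_subst2 P p ^+ n.
Proof. by move=> P0; exact: (rmorphXn (fps_subst2_rmorphism P0)). Qed.

Lemma fps_subst2M P p q : P 0%N 0%N = 0 ->
  fps_subst2 P (p * q) = fps_subst2 P p * fps_subst2 P q.
Proof. by move=> P0; exact: (rmorphM (fps_subst2_rmorphism P0)). Qed.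

Lemma fps_subst2_coef00 P p : P 0%N 0%N = 0 -> fps_subst2 P p 0%N 0%N = p 0%N.
Proof.
by move=> P0; rewrite (@fps_subst2E _ _ _ _ 1) // big_ord1 expr0 mulr1.
Qed.

Lemma fps_subst2_comp P p q : P 0%N 0%N = 0 -> p 0%N = 0 ->
  fps_subst2 (fps_subst2 P p) q = fps_subst2 P (fps_comp q p).
Proof.
move=> P0 p0; have Pp0 : fps_subst2 P p 0%N 0%N = 0 by rewrite fps_subst2_coef00.
apply: (@fps_hom_ext _ _ fil2 (fps_subst2_rmorphism Pp0)
  (fps_subst2_rmorphism P0 \o fps_comp_rmorphism p0)).
- move=> a; rewrite [LHS]fps_subst2C //.
  by rewrite [RHS](congr1 (fps_subst2 P) (fps_compC a p0)) fps_subst2C.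
- by rewrite [LHS]fps_subst2X // [RHS](congr1 (fps_subst2 P) (fps_compX p0)).
- by apply: fps2_vanish0; rewrite [LHS](fps_subst2_coef00 (fpsX A)).
Qed.

Lemma fps_subst2_coef0 P p : P 0%N 0%N = 0 ->
  fps_subst2 P p 0%N = fps_comp p (P 0%N).
Proof.
move=> P0; apply: fpsP => a.
rewrite (@fps_subst2E _ _ _ _ a.+1) // (@fps_compE _ _ _ _ a.+1) //.
by apply: eq_bigr => l _; rewrite -[P 0%N]/(fps_coef0 _ P) -rmorphXn.
Qed.

Lemma fps_subst2_row0 P p : P 0%N 0%N = 0 ->
  fps_map (fun r : {fps A} => r 0%N) (fps_subst2 P p) =
  fps_comp p (fps_map (fun r : {fps A} => r 0%N) P).
Proof.
move=> P0; apply: fpsP => b.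
rewrite [LHS](@fps_subst2E _ _ _ _ b.+1) ?addn0 // (@fps_compE _ _ _ _ b.+1) //.
apply: eq_bigr => l _; congr (_ * _).
by rewrite -(rmorphXn (fps_map (fps_coef0 A))).
Qed.

Lemma fps_hom_ext2 (B : comNzRingType) (v : filtration B)
    (f g : {rmorphism {fps {fps A}} -> B}) :
  (forall a, f (fpsC (fpsC a)) = g (fpsC (fpsC a))) ->
  f (fpsC (fpsX A)) = g (fpsC (fpsX A)) -> f (fpsX _) = g (fpsX _) ->
  v 1%N (f (fpsC (fpsX A))) -> v 1%N (f (fpsX _)) -> f =1 g.
Proof.
move=> fgC fgX fgY vX vY; apply: (@fps_hom_ext _ _ v) => // p.
exact: (@fps_hom_ext _ _ v (f \o @fpsC _) (g \o @fpsC _)).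
Qed.

End Subst2.

Arguments fps_subst2 : simpl never.

Lemma fps_subst2_map (A B : comNzRingType) (f : {rmorphism A -> B})
    (P : {fps {fps A}}) p : P 0%N 0%N = 0 ->
  fps_map (fps_map f) (fps_subst2 P p) =
  fps_subst2 (fps_map (fps_map f) P) (fps_map f p).
Proof.
move=> P0; apply: fpsP => b; apply: fpsP => a.
rewrite [RHS](@fps_subst2E _ _ _ _ _ (b + a).+1) //; last first.
  by rewrite !fps_map_coef P0 rmorph0.
rewrite !fps_map_coef (@fps_subst2E _ _ _ _ _ (b + a).+1) // rmorph_sum.
by apply: eq_bigr => l _; rewrite rmorphM -rmorphXn.
Qed.

Lemma fps_comp_map (A B : comNzRingType) (f : {rmorphism A -> B})
    (p g : {fps A}) : g 0%N = 0 ->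
  fps_map f (fps_comp p g) = fps_comp (fps_map f p) (fps_map f g).
Proof.
move=> g0; apply: fpsP => n.
rewrite [RHS](@fps_compE _ _ _ _ n.+1) //; last by rewrite fps_map_coef g0 rmorph0.
rewrite fps_map_coef (@fps_compE _ _ _ _ n.+1) // rmorph_sum.
by apply: eq_bigr => l _; rewrite rmorphM -rmorphXn.
Qed.

(** * The formal group F_g *)

Section Twist.
Variables (K : fieldType) (g : {fps K}).
Hypotheses (g0 : g 0%N = 0) (g1 : g 1%N = 1).
Implicit Types (F : {fps {fps K}}).

Let gC := fps_map (@fpsC K) g.
Let gC0 : gC 0%N = 0.
Proof. by rewrite /gC /= g0 rmorph0. Qed.

(** The substitution (x, y) -> (g(x), g(y)) built as a ring homomorphism; [fg_subst2E] identifies it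
    with the coefficient formula of [fg_subst2]. *)
Definition subst_both : {rmorphism {fps {fps K}} -> {fps {fps K}}} :=
  fps_comp_rmorphism gC0 \o fps_map (fps_comp_rmorphism g0).

Lemma subst_bothE F :
  subst_both F = fps_comp (fps_map (fps_comp_rmorphism g0) F) gC.
Proof. by []. Qed.

Lemma subst_both_coef F b a N : (b < N)%N -> (a < N)%N ->
  subst_both F b a =
  \sum_(j < N) \sum_(i < N) F j i * ((g ^+ i) a * (g ^+ j) b).
Proof.
move=> bN aN; rewrite subst_bothE (@fps_compE _ _ _ _ N) // fps_coef_sum.
apply: eq_bigr => j _; rewrite -rmorphXn [fps_map _ _ b]fps_map_coef mulrC fps_coefCM (@fps_compE _ _ _ _ N) //.
by rewrite mulr_sumr; apply: eq_bigr => i _; ring.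
Qed.

Lemma fg_subst2E F : fg_subst2 F g = subst_both F.
Proof.
apply: fpsP => b; apply: fpsP => a; pose N := (b + a).+1.
rewrite (@subst_both_coef _ _ _ N) ?ltnS ?leq_addr ?leq_addl //.
rewrite [LHS](@fsum_seq _ _ [seq (i, j) | j <- index_iota 0 N, i <- index_iota 0 N]).
- rewrite big_allpairs_dep big_mkord; apply: eq_bigr => j _.
  by rewrite big_mkord.
- by apply: allpairs_uniq; rewrite ?iota_uniq // => -[j i] [j' i'] _ _ /= [-> ->].
move=> [i j] ij0; apply: (@allpairs_f _ _ _ (fun j i => (i, j))).
  rewrite mem_index_iota ltnNge; apply: contraNN ij0 => Nij /=.
  by rewrite (@fps_coefX_lt _ _ j) ?mulr0 //; rewrite /N in Nij; lia.
rewrite mem_index_iota ltnNge; apply: contraNN ij0 => Nij /=.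
by rewrite (@fps_coefX_lt _ _ i) ?mul0r ?mulr0 //; rewrite /N in Nij; lia.
Qed.

Lemma subst_bothC a : subst_both (fpsC (fpsC a)) = fpsC (fpsC a).
Proof.
by rewrite subst_bothE fps_mapC fps_compC // fps_comp_rmorphismE fps_compC.
Qed.

Lemma subst_bothx : subst_both (fpsC (fpsX K)) = fpsC g.
Proof.
by rewrite subst_bothE fps_mapC fps_compC // fps_comp_rmorphismE fps_compX.
Qed.

Lemma subst_bothy : subst_both (fpsX _) = gC.
Proof. by rewrite subst_bothE fps_mapX fps_compX. Qed.

Lemma subst_both_coef0 F : subst_both F 0%N = fps_comp (F 0%N) g.
Proof. by rewrite subst_bothE fps_comp_coef0. Qed.

Lemma subst_both_row0 F :
  fps_map (fun r : {fps K} => r 0%N) (subst_both F) =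
  fps_comp (fps_map (fun r : {fps K} => r 0%N) F) g.
Proof.
apply: fpsP => b; rewrite (@fps_compE _ _ _ _ b.+1) //.
rewrite [LHS](@subst_both_coef F b 0 b.+1) //; apply: eq_bigr => j _.
rewrite big_ord_recl expr0 mul1r big1 ?addr0 // => i _.
by rewrite fps_coefX_lt ?mul0r ?mulr0.
Qed.

Lemma subst_both_coef00 F : subst_both F 0%N 0%N = F 0%N 0%N.
Proof. by rewrite subst_both_coef0 fps_comp_coef0. Qed.

(* With x, y, z the variables of the outer {fps _} read from the inside, the  *)
(* two substitutions are p(x, y) |-> p(x, P(y, z)) and                        *)
(* p(x, z) |-> p(P(x, y), z).                                                 *)
Definition subst_right (P : {fps {fps K}}) (p : {fps {fps K}}) :
    {fps {fps {fps K}}} :=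
  fps_subst2 (fps_map (fps_map (@fpsC K)) P) p.

Definition subst_left (P : {fps {fps K}}) (p : {fps {fps K}}) :
    {fps {fps {fps K}}} :=
  fps_map (fps_subst2 P) p.

Let hat00 (P : {fps {fps K}}) : P 0%N 0%N = 0 ->
  fps_map (fps_map (@fpsC K)) P 0%N 0%N = 0.
Proof. by move=> P0; rewrite !fps_map_coef P0 rmorph0. Qed.

(** Turns the coefficientwise form of associativity in [formal_group] into an equality of series in
    three variables, which can be handled by comparing homomorphisms. *)
Lemma fps_substA (P : {fps {fps K}}) : P 0%N 0%N = 0 ->
  subst_right P P = subst_left P P <->
  forall a b c : nat,
    \sum_(j \in [set: nat]) P j a * (P ^+ j) c b =
    \sum_(i \in [set: nat]) P c i * (P ^+ i) b a.
Proof.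
move=> P0; have coefE a b c : subst_right P P c b a =
    \sum_(j \in [set: nat]) P j a * (P ^+ j) c b.
  rewrite /subst_right (@fps_subst2E _ _ _ _ _ (c + b).+1) ?hat00 // fps_coef_sum.
  rewrite [RHS](@fsum_seq _ _ (index_iota 0 (c + b).+1)) ?iota_uniq //.
    rewrite big_mkord; apply: eq_bigr => j _; rewrite -rmorphXn !fps_map_coef.
    by rewrite mulrC fps_coefCM mulrC.
  move=> j; rewrite mem_index_iota; apply: contraNT; rewrite -leqNgt => lj.
  by rewrite fps2_coefX_lt ?mulr0.
split=> [e a b c|e]; first by rewrite -coefE e.
by apply: fpsP => c; apply: fpsP => b; apply: fpsP => a; rewrite coefE e.
Qed.

Let v3 := fps_fil (fil2 K).

Let v3_vanish (p : {fps {fps {fps K}}}) : p 0%N 0%N 0%N = 0 -> v3 1%N p.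
Proof. by move=> p0 [|c] [|b] [|a]; [right|left|left|left|left|left|left|left]. Qed.

Let g3 := fps_map (@fpsC {fps K}) gC.
Let g30 : g3 0%N = 0.
Proof. by rewrite /g3 fps_map_coef gC0 rmorph0. Qed.

(** Replaces each of the three variables x, y, z by g of it. *)
Let subst_all : {rmorphism {fps {fps {fps K}}} -> {fps {fps {fps K}}}} :=
  fps_comp_rmorphism g30 \o fps_map subst_both.

Let subst_all_C p : subst_all (fpsC p) = fpsC (subst_both p).
Proof.
have -> : subst_all (fpsC p) = fps_comp (fps_map subst_both (fpsC p)) g3 by [].
by rewrite fps_mapC fps_compC.
Qed.

Let subst_all_X : subst_all (fpsX _) = g3.
Proof.
have -> : subst_all (fpsX _) = fps_comp (fps_map subst_both (fpsX _)) g3 by [].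
by rewrite fps_mapX fps_compX.
Qed.

Let g3E : g3 = fps_map (fps_map (@fpsC K)) gC.
Proof.
apply: fpsP => n; rewrite /g3 /gC !fps_map_coef.
exact/esym/(fps_mapC (@fpsC K)).
Qed.

(** Reads p(x, y) as p(y, z). *)
Let hat := fps_map (fps_map (@fpsC K)).

Let hatC p : hat (fpsC p) = fpsC (fps_map (@fpsC K) p).
Proof. exact: fps_mapC. Qed.

Let mapCC a : fps_map (@fpsC K) (fpsC a) = fpsC (fpsC a).
Proof. exact: (fps_mapC (@fpsC K)). Qed.

Let hatX : hat (fpsX _) = fpsX _.
Proof. exact: fps_mapX. Qed.

Let mapCX : fps_map (@fpsC K) (fpsX K) = fpsX _.
Proof. exact: (fps_mapX (@fpsC K)). Qed.

Let subst_all_hat (p : {fps {fps K}}) : subst_all (hat p) = hat (subst_both p).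
Proof.
pose f : {rmorphism _ -> _} := subst_all \o fps_map (fps_map (@fpsC K)).
pose f' : {rmorphism _ -> _} := fps_map (fps_map (@fpsC K)) \o subst_both.
have eX : f (fpsC (fpsX K)) = fpsC gC.
  change (subst_all (hat (fpsC (fpsX K))) = fpsC gC).
  by rewrite hatC mapCX subst_all_C subst_bothy.
have eY : f (fpsX _) = g3.
  by change (subst_all (hat (fpsX _)) = g3); rewrite hatX subst_all_X.
apply: (@fps_hom_ext2 _ _ v3 f f').
- move=> a; change (subst_all (hat (fpsC (fpsC a))) = hat (subst_both (fpsC (fpsC a)))).
  by rewrite subst_bothC hatC mapCC subst_all_C subst_bothC.
- rewrite eX; change (fpsC gC = hat (subst_both (fpsC (fpsX K)))).
  by rewrite subst_bothx hatC.
- rewrite eY; change (g3 = hat (subst_both (fpsX _))).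
  by rewrite subst_bothy g3E.
- by rewrite eX; apply: v3_vanish; change (gC 0%N 0%N = 0); rewrite gC0.
by rewrite eY; apply: v3_vanish; rewrite g30.
Qed.

Section FormalGroup.
Variable F : {fps {fps K}}.
Hypothesis hF : formal_group F.

Let F00 : F 0%N 0%N = 0.
Proof. by rewrite (formal_groupx0 hF). Qed.

Let S := fg_subst2 F g.
Let S00 : S 0%N 0%N = 0.
Proof. by rewrite /S fg_subst2E subst_both_coef00. Qed.

Let H := fps_compinv g.
Let HP := fps_compinvP g0 g1.
Let H0 : H 0%N = 0. Proof. by case: HP. Qed.

Lemma fg_twistE : fg_twist F g = fps_subst2 S H.
Proof. by []. Qed.

Lemma fg_twist_coef00 : fg_twist F g 0%N 0%N = 0.
Proof. by rewrite fg_twistE fps_subst2_coef00. Qed.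

(** F_g is g^{-1} applied to F(g(x), g(y)), so applying g undoes the inverse. *)
Lemma fg_twist_subst : fps_subst2 (fg_twist F g) g = fg_subst2 F g.
Proof. by rewrite fg_twistE fps_subst2_comp //; case: HP => _ -> _; rewrite fps_subst2X. Qed.

Let Fg := fg_twist F g.

Let subst_right_rmorphism (P : {fps {fps K}}) (P0 : P 0%N 0%N = 0) :
    {rmorphism {fps {fps K}} -> {fps {fps {fps K}}}} :=
  fps_subst2_rmorphism (hat00 P0).

Let subst_left_rmorphism (P : {fps {fps K}}) (P0 : P 0%N 0%N = 0) :
    {rmorphism {fps {fps K}} -> {fps {fps {fps K}}}} :=
  fps_map (fps_subst2_rmorphism P0).

(** Both sides are p(g(x), F(g(y), g(z))), the left one because g(F_g(y, z)) = F(g(y), g(z)). As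
    homomorphisms in p they are compared on x and y. *)
Let subst_right_both p : subst_right Fg (subst_both p) = subst_all (subst_right F p).
Proof.
pose f : {rmorphism _ -> _} := subst_right_rmorphism fg_twist_coef00 \o subst_both.
pose f' : {rmorphism _ -> _} := subst_all \o subst_right_rmorphism F00.
have eX : f (fpsC (fpsX K)) = fpsC (fpsC g).
  change (subst_right Fg (subst_both (fpsC (fpsX K))) = fpsC (fpsC g)).
  by rewrite subst_bothx /subst_right fps_subst2C // hat00 // fg_twist_coef00.
have eY : f (fpsX _) = hat S.
  change (subst_right Fg (subst_both (fpsX _)) = hat S).
  rewrite subst_bothy /subst_right -[fps_map (fps_map _) _]/(hat Fg).
  by rewrite -(fps_subst2_map (@fpsC K)) ?fg_twist_coef00 // fg_twist_subst.
apply: (@fps_hom_ext2 _ _ v3 f f').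
- move=> a; change (subst_right Fg (subst_both (fpsC (fpsC a))) =
    subst_all (subst_right F (fpsC (fpsC a)))).
  rewrite subst_bothC /subst_right !fps_subst2C ?hat00 ?fg_twist_coef00 //.
  by rewrite subst_all_C subst_bothC.
- rewrite eX; change (fpsC (fpsC g) = subst_all (subst_right F (fpsC (fpsX K)))).
  by rewrite /subst_right fps_subst2C ?hat00 // subst_all_C subst_bothx.
- rewrite eY; change (hat S = subst_all (subst_right F (fpsX _))).
  by rewrite /subst_right fps_subst2X ?hat00 // subst_all_hat /S fg_subst2E.
- by rewrite eX; apply: v3_vanish; exact: g0.
by rewrite eY; apply: v3_vanish; rewrite !fps_map_coef S00 rmorph0.
Qed.

(** The mirror image: both sides are p(F(g(x), g(y)), g(z)). *)
Let subst_left_both p : subst_left Fg (subst_both p) = subst_all (subst_left F p).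
Proof.
pose f : {rmorphism _ -> _} := subst_left_rmorphism fg_twist_coef00 \o subst_both.
pose f' : {rmorphism _ -> _} := subst_all \o subst_left_rmorphism F00.
have leftC (P : {fps {fps K}}) q (P0 : P 0%N 0%N = 0) : subst_left P (fpsC q) = fpsC (fps_subst2 P q).
  exact: (fps_mapC (fps_subst2_rmorphism P0)).
have leftX (P : {fps {fps K}}) (P0 : P 0%N 0%N = 0) : subst_left P (fpsX _) = fpsX _.
  exact: (fps_mapX (fps_subst2_rmorphism P0)).
have eX : f (fpsC (fpsX K)) = fpsC S.
  change (subst_left Fg (subst_both (fpsC (fpsX K))) = fpsC S).
  by rewrite subst_bothx leftC ?fg_twist_coef00 // fg_twist_subst.
have eY : f (fpsX _) = g3.
  change (subst_left Fg (subst_both (fpsX _)) = g3).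
  rewrite subst_bothy; apply: fpsP => n; rewrite /subst_left /g3 /gC !fps_map_coef.
  by rewrite fps_subst2C // fg_twist_coef00.
apply: (@fps_hom_ext2 _ _ v3 f f').
- move=> a; change (subst_left Fg (subst_both (fpsC (fpsC a))) =
    subst_all (subst_left F (fpsC (fpsC a)))).
  rewrite subst_bothC !leftC ?fg_twist_coef00 // !fps_subst2C ?fg_twist_coef00 //.
  by rewrite subst_all_C subst_bothC.
- rewrite eX; change (fpsC S = subst_all (subst_left F (fpsC (fpsX K)))).
  by rewrite leftC // fps_subst2X // subst_all_C /S fg_subst2E.
- rewrite eY; change (g3 = subst_all (subst_left F (fpsX _))).
  by rewrite leftX // subst_all_X.
- by rewrite eX; apply: v3_vanish; exact: S00.
by rewrite eY; apply: v3_vanish; rewrite g30.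
Qed.

(** With S = F(g(x), g(y)), both sides are homomorphisms evaluated at F_g = g^{-1}(S), so it
    suffices that they agree on S. There the two preceding lemmas reduce the claim to associativity
    of F. *)
Lemma fg_twistA : subst_right Fg Fg = subst_left Fg Fg.
Proof.
pose f : {rmorphism _ -> _} :=
  subst_right_rmorphism fg_twist_coef00 \o fps_subst2_rmorphism S00.
pose f' : {rmorphism _ -> _} :=
  subst_left_rmorphism fg_twist_coef00 \o fps_subst2_rmorphism S00.
have eX : f (fpsX K) = subst_right Fg S.
  by change (subst_right Fg (fps_subst2 S (fpsX K)) = subst_right Fg S); rewrite fps_subst2X.
apply: (@fps_hom_ext _ _ v3 f f').
- move=> a; change (subst_right Fg (fps_subst2 S (fpsC a)) =
    subst_left Fg (fps_subst2 S (fpsC a))).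
  rewrite fps_subst2C // /subst_right fps_subst2C ?hat00 ?fg_twist_coef00 //.
  rewrite -[subst_left _ _]/(fps_map (fps_subst2_rmorphism fg_twist_coef00) _).
  by rewrite fps_mapC; congr fpsC; rewrite [RHS]fps_subst2C // fg_twist_coef00.
- rewrite eX; change (subst_right Fg S = subst_left Fg (fps_subst2 S (fpsX K))).
  rewrite fps_subst2X // /S fg_subst2E subst_right_both subst_left_both.
  by congr (subst_all _); apply/(fps_substA F00); exact: formal_groupA hF.
rewrite eX; apply: v3_vanish.
by rewrite /subst_right fps_subst2_coef00 ?hat00 ?fg_twist_coef00 // S00.
Qed.

Lemma fg_twistx0 : fg_twist F g 0%N = fpsX K.
Proof.
rewrite fg_twistE fps_subst2_coef0 // /S fg_subst2E subst_both_coef0.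
by rewrite (formal_groupx0 hF) fps_compX //; case: HP.
Qed.

Lemma fg_twist0y : fps_map (fun p : {fps K} => p 0%N) (fg_twist F g) = fpsX K.
Proof.
rewrite fg_twistE fps_subst2_row0 // /S fg_subst2E subst_both_row0.
by rewrite (formal_group0y hF) fps_compX //; case: HP.
Qed.

Lemma fg_twistP : formal_group (fg_twist F g).
Proof.
split; [exact: fg_twistx0|exact: fg_twist0y|].
by apply/(fps_substA fg_twist_coef00); exact: fg_twistA.
Qed.

End FormalGroup.
End Twist.

(** * Laurent series *)

Section LaurentBasics.
Variable A : comNzRingType.
Implicit Types (f g : {laurent A}) (p q : {fps A}).

Lemma laurent_coefM f g n :
  (f * g) n = \sum_(i \in [set: int]) f i * g (n - i).
Proof. by []. Qed.

Lemma laurent_coef_sum (I : Type) (r : seq I) (P : pred I)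
    (F : I -> {laurent A}) n :
  (\sum_(i <- r | P i) F i) n = \sum_(i <- r | P i) F i n.
Proof.
apply: (big_morph (fun p : {laurent A} => p n)) => //=.
by case: ifP => // _; case: ifP.
Qed.

Lemma laurent_coef0 n : (0 : {laurent A}) n = 0.
Proof. by rewrite /=; case: ifP => // _; case: ifP. Qed.

Lemma laurent_coef1 n : (1 : {laurent A}) n = (n == 0)%:R.
Proof. by case: n => [[|n]|n]. Qed.

Fact laurent_of_fps_zmod : zmod_morphism (@laurent_of_fps A).
Proof. by move=> p q; apply: laurentP => n /=; case: ifP; rewrite ?subr0. Qed.
Fact laurent_of_fps_monoid : monoid_morphism (@laurent_of_fps A).
Proof. by split=> // p q; rewrite [RHS]laurent_mul_tpow addr0. Qed.
HB.instance Definition _ := GRing.isZmodMorphism.Build _ _ _ laurent_of_fps_zmod.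
HB.instance Definition _ := GRing.isMonoidMorphism.Build _ _ _ laurent_of_fps_monoid.

Lemma tpow_mulM N M p q :
  tpow_mul N p * tpow_mul M q = tpow_mul (N + M) (p * q).
Proof. exact: laurent_mul_tpow. Qed.

Lemma laurentX_of_fps : laurentX A = laurent_of_fps (fpsX A).
Proof.
by apply: laurentP => -[[|[|n]]|n].
Qed.

Lemma laurentX_unit : laurentX A \is a GRing.unit.
Proof.
by apply: (@invertiblePl {laurent A} _ (tpow_mul (-1) 1)); rewrite tpow_mulM mul1r.
Qed.

Lemma laurentXz N : laurentX A ^ N = tpow_mul N 1.
Proof.
have Xn n : laurentX A ^+ n = tpow_mul n%:Z 1.
  by elim: n => // n IH; rewrite exprS IH tpow_mulM mulr1 -intS.
case: N => [n|n]; first exact: Xn.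
apply: (mulrI (unitrX n.+1 laurentX_unit)).
by rewrite NegzE -exprnN mulrV ?unitrX ?laurentX_unit // Xn tpow_mulM mulr1 subrr.
Qed.

Lemma tpow_mulE N p : tpow_mul N p = laurentX A ^ N * laurent_of_fps p.
Proof. by rewrite laurentXz tpow_mulM addr0 mul1r. Qed.

Lemma tpow_mul_inj N : injective (@tpow_mul A N).
Proof.
move=> p q pq; apply: fpsP => n.
have := congr1 (fun f : {laurent A} => f (N + n%:Z)) pq.
by rewrite /= ler_wpDr // addrAC subrr add0r.
Qed.

Definition ord_ge (N : int) f := forall n, n < N -> f n = 0.

Lemma ord_ge_le N M f : M <= N -> ord_ge N f -> ord_ge M f.
Proof. by move=> MN fN n nM; apply: fN; exact: lt_le_trans nM MN. Qed.

Lemma ord_geD N f g : ord_ge N f -> ord_ge N g -> ord_ge N (f + g).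
Proof.
by move=> fN gN n nN; change (f n + g n = 0); rewrite fN // gN // addr0.
Qed.

Lemma ord_geN N f : ord_ge N f -> ord_ge N (- f).
Proof. by move=> fN n nN; change (- f n = 0); rewrite fN // oppr0. Qed.

Lemma ord_ge_sum N (I : Type) (r : seq I) (P : pred I) (F : I -> {laurent A}) :
  (forall i, P i -> ord_ge N (F i)) -> ord_ge N (\sum_(i <- r | P i) F i).
Proof.
move=> FN n nN; rewrite laurent_coef_sum big1 // => i Pi; exact: FN.
Qed.

Lemma ord_geM N M f g : ord_ge N f -> ord_ge M g -> ord_ge (N + M) (f * g).
Proof.
move=> fN gM n nNM; rewrite laurent_coefM; apply: fsbig1 => i _.
have [iN|Ni] := ltP i N; first by rewrite fN // mul0r.
by rewrite gM ?mulr0 //; lia.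
Qed.

Lemma ord_ge_tpow N p : ord_ge N (tpow_mul N p).
Proof. by move=> n nN /=; rewrite leNgt nN. Qed.

End LaurentBasics.

Section LaurentExt.
Variables (A : comNzRingType) (B : comUnitRingType).
Variable rho : {rmorphism {fps A} -> B}.
Hypothesis rhoX : rho (fpsX A) \is a GRing.unit.

(** The extension of [rho] to Laurent series, available since the image of t is invertible. The
    lower bound N is an arbitrary choice; [laurent_ext_tpow] shows that any other one gives the same
    value. *)
Definition laurent_ext (f : {laurent A}) : B :=
  let N := sval (cid (laurent_trunc f)) in
  rho (fpsX A) ^ N * rho (Fps (fun k => f (N + k%:Z))).

Lemma laurent_ext_tpow N p :
  laurent_ext (tpow_mul N p) = rho (fpsX A) ^ N * rho p.
Proof.
rewrite /laurent_ext; case: cid => M /= fM; set q := Fps _.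
have e : tpow_mul M q = tpow_mul N p by exact/esym/(@laurent_tpowE _ (tpow_mul N p) M fM).
move: q e => q e {fM}.
have key (d : nat) L (r s : {fps A}) : tpow_mul (L + d%:Z) r = tpow_mul L s ->
    rho (fpsX A) ^ (L + d%:Z) * rho r = rho (fpsX A) ^ L * rho s.
  move=> ers; have -> : s = fpsX A ^+ d * r.
    apply: (@tpow_mul_inj _ L); rewrite -ers !tpow_mulE exprzDr ?laurentX_unit //.
    by rewrite rmorphM rmorphXn [X in _ * (X ^+ _ * _)](esym (laurentX_of_fps A)) mulrA.
  by rewrite exprzDr // rmorphM rmorphXn mulrA.
have [MN|NM] := leP M N.
  by have := @key `|N - M|%N M p q; rewrite (_ : M + _ = N); [move=> ->|lia].
by have := @key `|M - N|%N N q p; rewrite (_ : N + _ = M); [apply|lia].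
Qed.

Lemma laurent_common (f g : {laurent A}) :
  exists N p q, f = tpow_mul N p /\ g = tpow_mul N q.
Proof.
have [[N fN] [M gM]] := (laurent_trunc f, laurent_trunc g).
pose L := Num.min N M; exists L, (Fps (fun k => f (L + k%:Z))), (Fps (fun k => g (L + k%:Z))).
by split; apply: laurent_tpowE => n; rewrite lt_min => /andP[? ?]; [apply: fN|apply: gM].
Qed.

Fact laurent_ext_zmod : zmod_morphism laurent_ext.
Proof.
move=> f g; have [N [p [q [-> ->]]]] := laurent_common f g.
have -> : tpow_mul N p - tpow_mul N q = tpow_mul N (p - q).
  by apply: laurentP => n /=; case: ifP; rewrite ?subr0.
by rewrite !laurent_ext_tpow rmorphB mulrBr.
Qed.

Fact laurent_ext_monoid : monoid_morphism laurent_ext.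
Proof.
split=> [|f g].
  by rewrite -[1]/(tpow_mul 0 1) laurent_ext_tpow rmorph1 expr0z mulr1.
have [N [p [q [-> ->]]]] := laurent_common f g.
by rewrite tpow_mulM !laurent_ext_tpow rmorphM exprzDr //; ring.
Qed.

Definition laurent_ext_rmorphism := to_rmorphism laurent_ext_zmod laurent_ext_monoid.

Lemma laurent_ext_of_fps p : laurent_ext (laurent_of_fps p) = rho p.
Proof. by rewrite laurent_ext_tpow expr0z mul1r. Qed.

(* A linear functional that kills the images of all series of high order sees *)
(* only finitely many terms of the image of a Laurent series.                 *)
Lemma laurent_ext_coef (c : B -> A) (M : int) (f : {laurent A}) :
  {morph c : a b / a + b} ->
  (forall a b, c (rho (fpsC a) * b) = a * c b) ->
  (forall m r, M <= m -> c (rho (fpsX A) ^ m * rho r) = 0) ->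
  c (laurent_ext f) = \sum_(m \in [set: int]) f m * c (rho (fpsX A) ^ m).
Proof.
move=> cD cZ cM; have [N fN] := laurent_trunc f.
set p := Fps (fun k => f (N + k%:Z)).
rewrite [in LHS](laurent_tpowE fN) laurent_ext_tpow.
(* [d] counts the degrees from N up to the point max(M, N) from which [c] vanishes. *)
pose d := `|Num.max M N - N|%N.
have -> : \sum_(m \in [set: int]) f m * c (rho (fpsX A) ^ m) =
    \sum_(k < d) p k * c (rho (fpsX A) ^ (N + k%:Z)).
  rewrite (@fsum_seq _ _ [seq N + k%:Z | k <- index_iota 0 d]).
  - by rewrite big_map big_mkord.
  - by rewrite map_inj_uniq ?iota_uniq // => i j; lia.
  move=> m; have [/fN ->|Nm] := ltP m N; first by rewrite mul0r eqxx.
  have [Mm|mM] := leP M m.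
    by rewrite -[_ ^ m]mulr1 -(rmorph1 rho) cM // mulr0 eqxx.
  move=> _; apply/mapP; exists `|m - N|%N; last by lia.
  by rewrite mem_index_iota /d; lia.
have Md : M <= N + d%:Z by rewrite /d; lia.
rewrite -/p; suff : forall (p : {fps A}), c (rho (fpsX A) ^ N * rho p) =
    \sum_(k < d) p k * c (rho (fpsX A) ^ (N + k%:Z)) by [].
(* Induction on d: split off the leading coefficient, then apply the hypothesis to the shift of p
   with N + 1 in place of N. *)
move: (d) Md; clear p fN d => d Md; elim: d N Md => [|d IH] N NM p.
  by rewrite big_ord0 cM //; rewrite addr0 in NM.
rewrite {1}(fps_shiftE p) rmorphD rmorphM mulrDr cD [_ * rho (fpsC _)]mulrC.
rewrite cZ big_ord_recl addr0; congr (_ + _).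
rewrite mulrA -{2}[rho (fpsX A)]expr1z -exprzDr // IH; last by lia.
by apply: eq_bigr => k _; congr (_ * c (_ ^ _)); rewrite /= /bump /=; lia.
Qed.

End LaurentExt.

(** * Bounds on the poles of integer powers *)

Section OrderBounds.
Variables (A : comNzRingType) (C : nat -> nat).
Hypothesis CD : forall i j, (C i + C j <= C (i + j))%N.
Implicit Types (m : int) (f : {fps {laurent A}}).

Let C0 : C 0%N = 0%N.
Proof. by have := CD 0 0; rewrite addn0; lia. Qed.

(* Superadditivity of C makes these sets a multiplicative filtration; as m    *)
(* ranges over int, it also controls negative powers.                         *)
Definition bounded_poles m f := forall k, ord_ge (m - (C k)%:Z) (f k).

Lemma bounded_polesM m n f h :
  bounded_poles m f -> bounded_poles n h -> bounded_poles (m + n) (f * h).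
Proof.
move=> fm hn k; rewrite fps_coefM; apply: ord_ge_sum => i _.
apply: ord_ge_le (ord_geM (fm i) (hn (k - i)%N)).
by have := CD i (k - i); rewrite subnKC -1?ltnS // => ?; lia.
Qed.

Lemma bounded_poles1 : bounded_poles 0 1.
Proof.
case=> [|k] n nk; last by rewrite [fps_coef _ _]/= laurent_coef0.
by rewrite [fps_coef _ _]/= laurent_coef1; case: eqP => // n0; move: nk; lia.
Qed.

Variable phi : {fps {laurent A}}.
Hypotheses (phi0 : phi 0%N = laurentX A) (phiC : bounded_poles 1 phi).

Lemma laurentX_fps_unit : phi \is a GRing.unit.
Proof.
by apply: (@fps_unit _ _ (laurentX A)^-1); rewrite phi0 mulVr ?laurentX_unit.
Qed.

(** The coefficient of z^k in phi phi^{-1} = 1 expresses x times the k-th coefficient of phi^{-1} by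
    earlier ones. Superadditivity of C bounds the poles of the products by C(k), and dividing by x
    costs one more order. *)
Let phiV : bounded_poles (-1) phi^-1.
Proof.
move=> k; elim/ltn_ind: k => k IH.
have : (phi * phi^-1) k = (1 : {fps {laurent A}}) k.
  by rewrite mulrV ?laurentX_fps_unit.
rewrite fps_coefM big_ord_recl subn0 phi0 => /(canRL (addrK _)) e.
have -> : phi^-1 k = tpow_mul (-1) 1 * (laurentX A * phi^-1 k).
  by rewrite mulrA [tpow_mul _ _ * _]tpow_mulM mulr1 mul1r.
rewrite e; apply: ord_geM; first exact: ord_ge_tpow.
apply: ord_geD.
  by have := @bounded_poles1 k; rewrite sub0r.
apply: ord_geN; apply: ord_ge_sum => i _.
have ik : (lift ord0 i <= k)%N by have := ltn_ord i; rewrite lift0.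
have ik' : (k - lift ord0 i < k)%N by have := ltn_ord i; rewrite lift0; lia.
apply: ord_ge_le (ord_geM (@phiC (lift ord0 i)) (IH _ ik')).
by have := CD (lift ord0 i) (k - lift ord0 i); rewrite subnKC //; lia.
Qed.

Lemma bounded_polesXz m : bounded_poles m (phi ^ m).
Proof.
have posX n (f : {fps {laurent A}}) e : bounded_poles e f ->
    bounded_poles (e * n%:Z) (f ^+ n).
  move=> fe; elim: n => [|n IH]; first by rewrite mulr0; exact: bounded_poles1.
  by rewrite exprS intS mulrDr mulr1; exact: bounded_polesM.
case: m => [n|n]; first by have := posX n phi 1 phiC; rewrite mul1r.
by have := posX n.+1 phi^-1 (-1) phiV; rewrite mulN1r NegzE -exprnN exprVn.
Qed.

End OrderBounds.

(** Any sequence of pole bounds is dominated by a superadditive one: take C(k) = k s(k), where s is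
    the nondecreasing sequence of partial sums of the given bounds. The condition at k = 0, where C
    vanishes, holds because phi(x, 0) = x. *)
Lemma bounded_polesP (A : comNzRingType) (phi : {fps {laurent A}}) :
  phi 0%N = laurentX A ->
  exists C : nat -> nat, [/\ forall i j, (C i + C j <= C (i + j))%N,
    {homo C : i j / (i <= j)%N} & bounded_poles C 1 phi].
Proof.
move=> phi0; have [N phiN] := choice (fun k => laurent_trunc (phi k)).
pose s k := (\sum_(i < k.+1) `|1 - N i|)%N.
have s_mono : {homo s : i j / (i <= j)%N}.
  move=> i j /subnK <-; elim: (j - i)%N => // d IH.
  by rewrite addSn (leq_trans IH) // /s [leqRHS]big_ord_recr leq_addr.
exists (fun k => (k * s k)%N); split.
- move=> i j; rewrite mulnDl leq_add // leq_mul2l s_mono ?orbT //.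
    exact: leq_addr.
  exact: leq_addl.
- by move=> i j ij; rewrite leq_mul // s_mono.
case=> [|k].
  rewrite phi0 mul0n subr0 => n n1 /=; case: ifP => //; lia.
move=> n nk; apply: phiN.
have : (`|1 - N k.+1| <= k.+1 * s k.+1)%N.
  by apply: leq_trans (leq_pmull _ _); rewrite // /s big_ord_recr leq_addl.
lia.
Qed.

(** * The change of variable on Laurent series *)

Section LaurentConst.
Variable A : comNzRingType.

Fact laurentC_zmod : zmod_morphism (@laurentC A).
Proof. exact: (rmorphB (@laurent_of_fps A \o @fpsC A)). Qed.
Fact laurentC_monoid : monoid_morphism (@laurentC A).
Proof.
split; first exact: (rmorph1 (@laurent_of_fps A \o @fpsC A)).
exact: (rmorphM (@laurent_of_fps A \o @fpsC A)).
Qed.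
HB.instance Definition _ := GRing.isZmodMorphism.Build _ _ _ laurentC_zmod.
HB.instance Definition _ := GRing.isMonoidMorphism.Build _ _ _ laurentC_monoid.

Lemma laurent_coefC (a : A) n : laurentC a n = if n == 0 then a else 0.
Proof. by case: n => [[|n]|n]. Qed.

Lemma laurent_coefCM (a : A) (f : {laurent A}) n : (laurentC a * f) n = a * f n.
Proof.
rewrite laurent_coefM (@fsum_one _ _ 0) ?subr0 ?laurent_coefC //.
by move=> i i0; rewrite laurent_coefC (negPf i0) mul0r.
Qed.

Lemma laurent_of_fps_coef (p : {fps A}) (n : nat) : laurent_of_fps p n%:Z = p n.
Proof. by change (p `|(n%:Z - 0)%R|%N = p n); rewrite subr0. Qed.

Lemma laurent_of_fps_neg (p : {fps A}) (n : int) : n < 0 -> laurent_of_fps p n = 0.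
Proof. by move=> n0 /=; rewrite leNgt n0. Qed.

End LaurentConst.

Arguments laurent_of_fps : simpl never.
Arguments laurentC : simpl never.

Section Gamma.
Variables (K : fieldType) (g : {fps K}).
Hypotheses (g0 : g 0%N = 0) (g1 : g 1%N = 1).

(** The matrix of the substitution x -> g(x) in the basis of monomials x^m. It vanishes for n < m
    and is 1 on the diagonal ([gamma_lt], [gamma_diag]). *)
Definition gamma (m n : int) : K := (laurent_of_fps g ^ m) n.

Let u := fps_shift g.

Lemma fps_shift_unit : u \is a GRing.unit.
Proof. by apply: (@fps_unit _ _ 1); rewrite mul1r. Qed.

Lemma laurent_gE : laurent_of_fps g = laurentX K * laurent_of_fps u.
Proof.
by rewrite laurentX_of_fps -rmorphM {1}[g]fps_shiftE g0 rmorph0 add0r.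
Qed.

Lemma laurent_g_unit : laurent_of_fps g \is a GRing.unit.
Proof.
rewrite laurent_gE unitrM laurentX_unit.
by apply: (rmorph_unit (@laurent_of_fps K)); exact: fps_shift_unit.
Qed.

Lemma laurent_gXz m : laurent_of_fps g ^ m = tpow_mul m (u ^ m).
Proof.
rewrite laurent_gE exprMz_comm ?laurentX_unit //; last 2 first.
- by apply: (rmorph_unit (@laurent_of_fps K)); exact: fps_shift_unit.
- exact: mulrC.
by rewrite tpow_mulE (rmorphXz (@laurent_of_fps K)) // fps_shift_unit.
Qed.

Lemma gamma_lt m n : n < m -> gamma m n = 0.
Proof. by move=> nm; rewrite /gamma laurent_gXz /= leNgt nm. Qed.

Lemma gamma_neq0 m n : gamma m n != 0 -> m <= n.
Proof. by rewrite leNgt; apply: contraNN => /gamma_lt ->. Qed.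

Lemma gamma_diag m : gamma m m = 1.
Proof.
rewrite /gamma laurent_gXz /= lexx subrr.
rewrite -[LHS]/(fps_coef0 K (u ^ m)) (rmorphXz (fps_coef0 K)) ?fps_shift_unit //.
by rewrite [fps_coef0 K u]/= g1 exp1rz.
Qed.

Lemma gamma0 n : gamma 0 n = (n == 0)%:R.
Proof. by rewrite /gamma expr0z laurent_coef1. Qed.

Lemma gammaD m n a :
  gamma (m + n) a = \sum_(i \in [set: int]) gamma m i * gamma n (a - i).
Proof. by rewrite /gamma exprzDr ?laurent_g_unit // laurent_coefM. Qed.

Lemma gamma_nat (m n : nat) : gamma m n = (g ^+ m) n.
Proof. by rewrite /gamma -exprnP -rmorphXn laurent_of_fps_coef. Qed.

Let rho : {rmorphism {fps K} -> {laurent K}} := @laurent_of_fps K \o fps_comp_rmorphism g0.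

Let rhoE p : rho p = laurent_of_fps (fps_comp p g). Proof. by []. Qed.

Let rhoX_unit : rho (fpsX K) \is a GRing.unit.
Proof. by rewrite rhoE fps_compX // laurent_g_unit. Qed.

Definition laurent_subst : {rmorphism {laurent K} -> {laurent K}} :=
  laurent_ext_rmorphism rhoX_unit.

Lemma laurent_subst_of_fps p :
  laurent_subst (laurent_of_fps p) = laurent_of_fps (fps_comp p g).
Proof. exact: laurent_ext_of_fps. Qed.

Lemma laurent_subst_coef (f : {laurent K}) n :
  laurent_subst f n = \sum_(m \in [set: int]) f m * gamma m n.
Proof.
have -> := (@laurent_ext_coef _ _ _ rhoX_unit (fun h : {laurent K} => h n) (n + 1) f).
- by rewrite rhoE fps_compX.
- by [].
- by move=> a b; rewrite rhoE fps_compC // -laurent_coefCM.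
move=> m r nm; rewrite rhoE fps_compX // laurent_gXz tpow_mulM.
by rewrite /= ifF //; lia.
Qed.

Definition fps_laurentC : {fps {laurent K}} := fps_map (@laurentC K) g.

Lemma fps_laurentC0 : fps_laurentC 0%N = 0.
Proof. by rewrite /fps_laurentC fps_map_coef g0 rmorph0. Qed.

Lemma associate_twistE phi :
  associate_twist phi g = fps_comp_rmorphism fps_laurentC0 phi.
Proof. by []. Qed.

Lemma associate_twist_coef phi N a n : (a < N)%N ->
  associate_twist phi g a n = \sum_(i < N) phi i n * (g ^+ i) a.
Proof.
move=> aN; rewrite [LHS](congr1 (fun f : {laurent K} => f n) (@fps_compE _ phi fps_laurentC a N fps_laurentC0 aN)).
rewrite laurent_coef_sum; apply: eq_bigr => i _.
by rewrite /fps_laurentC -rmorphXn fps_map_coef mulrC laurent_coefCM mulrC.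
Qed.

(* The substitution x -> g(x), z -> g(z) on K((x))[[z]]. *)
Definition laurent_subst_both : {rmorphism {fps {laurent K}} -> {fps {laurent K}}} :=
  fps_comp_rmorphism fps_laurentC0 \o fps_map laurent_subst.

Lemma laurent_subst_bothE f :
  laurent_subst_both f = associate_twist (fps_map laurent_subst f) g.
Proof. by []. Qed.

Lemma laurent_subst_both_embed (p : {fps {fps K}}) :
  laurent_subst_both (embed2 p) = embed2 (subst_both g0 p).
Proof.
have e : fps_map laurent_subst (embed2 p) =
    fps_map (@laurent_of_fps K) (fps_map (fps_comp_rmorphism g0) p).
  by apply: fpsP => n; exact: laurent_subst_of_fps.
rewrite laurent_subst_bothE e /embed2 subst_bothE.
rewrite (fps_comp_map (@laurent_of_fps K)) //.
by rewrite fps_map_coef g0 rmorph0.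
Qed.

End Gamma.

(** * Integer powers of F and of F_g *)

Section TwistedPowers.
Variables (K : fieldType) (g : {fps K}) (F : {fps {fps K}}).
Hypotheses (g0 : g 0%N = 0) (g1 : g 1%N = 1) (hF : formal_group F).

Lemma embed2X0 (P : {fps {fps K}}) : P 0%N = fpsX K -> embed2 P 0%N = laurentX K.
Proof. by move=> P0; rewrite laurentX_of_fps -P0. Qed.

Lemma embed2_poles (P : {fps {fps K}}) : bounded_poles id 0 (embed2 P).
Proof. by move=> k n nk; rewrite /embed2 fps_map_coef laurent_of_fps_neg //; lia. Qed.

Lemma embed2_poles1 (P : {fps {fps K}}) : P 0%N = fpsX K ->
  bounded_poles id 1 (embed2 P).
Proof.
move=> P0 [|k]; first by rewrite embed2X0 // => n; exact: ord_ge_tpow.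
by move=> n nk; rewrite /embed2 fps_map_coef laurent_of_fps_neg //; lia.
Qed.

Let Fg := fg_twist F g.
Let Fg0 : Fg 0%N = fpsX K. Proof. exact: fg_twistx0. Qed.

Lemma embed2_unit (P : {fps {fps K}}) : P 0%N = fpsX K -> embed2 P \is a GRing.unit.
Proof. by move=> P0; apply: laurentX_fps_unit; exact: embed2X0. Qed.

(** With C the identity, the pole bound says that each monomial x^a y^b of P^m satisfies a + b >= m,
    also for negative m. *)
Lemma embed2Xz_poles (P : {fps {fps K}}) m : P 0%N = fpsX K ->
  bounded_poles id m (embed2 P ^ m).
Proof.
by move=> P0; apply: bounded_polesXz => //; [exact: embed2X0|exact: embed2_poles1].
Qed.

Let rho : {rmorphism {fps K} -> {fps {laurent K}}} :=
  fps_map (@laurent_of_fps K) \o fps_subst2_rmorphism (fg_twist_coef00 g0 g1 hF).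

Let rhoE p : rho p = embed2 (fps_subst2 Fg p). Proof. by []. Qed.

Let rhoX : rho (fpsX K) = embed2 Fg.
Proof. by rewrite rhoE fps_subst2X // fg_twist_coef00. Qed.

Let rhoX_unit : rho (fpsX K) \is a GRing.unit.
Proof. by rewrite rhoX embed2_unit. Qed.

(* Both sides are F(g(x), g(y))^m = g(F_g(x, y))^m. *)
Lemma laurent_subst_both_pow (m : int) (a : int) (b : nat) :
  laurent_subst_both g0 g1 (embed2 F ^ m) b a =
  \sum_(k \in [set: int]) gamma g m k * (embed2 Fg ^ k) b a.
Proof.
have Eu : embed2 F \is a GRing.unit by rewrite embed2_unit ?(formal_groupx0 hF).
(* [sigma] is the substitution t -> F_g(x, y) on Laurent series in t. *)
pose sigma := laurent_ext_rmorphism rhoX_unit.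
have gE : laurent_subst_both g0 g1 (embed2 F) = sigma (laurent_of_fps g).
  rewrite laurent_subst_both_embed -fg_subst2E -(fg_twist_subst g0 g1 hF).
  rewrite -rhoE.
  exact: (esym (laurent_ext_of_fps rhoX_unit g)).
have -> : laurent_subst_both g0 g1 (embed2 F ^ m) = sigma (laurent_of_fps g ^ m).
  apply: (eq_trans (rmorphXz (laurent_subst_both g0 g1) m Eu)).
  rewrite [X in X ^ m]gE; apply/esym/(rmorphXz sigma m).
  exact: laurent_g_unit.
(* The bound a + b + 1: for k > a + b no monomial x^a y^b occurs in F_g^k times a power series. *)
rewrite [LHS](@laurent_ext_coef _ _ _ rhoX_unit (fun h : {fps {laurent K}} => h b a) (a + b%:Z + 1)).
- by rewrite rhoX.
- by [].
- move=> c h.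
  have -> : rho (fpsC c) = fpsC (laurentC c).
    rewrite rhoE (fps_subst2C _ (fg_twist_coef00 g0 g1 hF)).
    exact: (fps_mapC (@laurent_of_fps K)).
  by rewrite fps_coefCM laurent_coefCM.
move=> k r abk; rewrite rhoX rhoE.
have := @bounded_polesM _ id (fun i j => leqnn _) k 0 _ _ (@embed2Xz_poles _ k Fg0) (@embed2_poles (fps_subst2 Fg r)).
by apply; rewrite /=; lia.
Qed.

End TwistedPowers.

(** * Twisted associates *)

Lemma associate_twistXz (K : fieldType) (g : {fps K}) (phi : {fps {laurent K}}) m :
  g 0%N = 0 -> phi 0%N = laurentX K ->
  associate_twist phi g ^ m = associate_twist (phi ^ m) g.
Proof.
move=> g0 phi0; rewrite !(associate_twistE g0); apply: (esym (rmorphXz _ m _)).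
exact: laurentX_fps_unit phi0.
Qed.

Section AssociateTwist.
Variables (K : fieldType) (g : {fps K}) (F : {fps {fps K}}) (phi : {fps {laurent K}}).
Hypotheses (g0 : g 0%N = 0) (g1 : g 1%N = 1).
Hypotheses (hF : formal_group F) (hphi : associate F phi).

Let phi0 : phi 0%N = laurentX K. Proof. exact: associatex0 hphi. Qed.

(** Outside the range from [lo] to [hi] one of the two factors vanishes. The fixed list of exponents
    allows the sum over m to be exchanged with the finite sums over powers of g. *)
Lemma associate_twist_unfold (n : int) (i i' : nat) (lo hi : int) :
  (forall m, m < lo -> phi i m = 0) ->
  (forall m, hi < m -> (phi ^ m) i' n = 0) ->
  \sum_(m <- [seq lo + k%:Z | k <- index_iota 0 `|Num.max hi lo - lo|.+1])
    phi i m * (phi ^ m) i' n =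
  \sum_(l \in [set: nat]) phi l n * (F ^+ l) i i'.
Proof.
move=> lo_phi hi_phi; rewrite -(associateA hphi); apply/esym/fsum_seq.
  by rewrite map_inj_uniq ?iota_uniq // => a b; lia.
move=> m; have [/lo_phi ->|lom] := ltP m lo; first by rewrite mul0r eqxx.
have [/hi_phi ->|mhi] := ltP hi m; first by rewrite mulr0 eqxx.
by move=> _; apply/mapP; exists `|m - lo|%N; rewrite ?mem_index_iota; lia.
Qed.

(** The claim is phi(phi(x, g(y)), g(z)) = phi(x, g(F_g(y, z))), whose right side is phi(x, F(g(y),
    g(z))). Expanding in powers of g(y) and g(z) reduces it to the finitely many coefficients of the
    identity for phi of degree at most j in y and k in z. *)
Lemma associate_twistP : associate (fg_twist F g) (associate_twist phi g).
Proof.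
split.
  by rewrite -phi0; apply: fps_comp_coef0; exact: fps_laurentC0.
move=> n j k; pose N := (j + k).+1.
have jN : (j < N)%N by rewrite /N; lia.
have kN : (k < N)%N by rewrite /N; lia.
have [C [CD Cmono phiC]] := bounded_polesP phi0.
have phiXC := bounded_polesXz CD phi0 phiC.
(* For i < N, phi_i has order at least 1 - C(N) in x and (phi^m)_i has order at least m - C(N); so
   only m from [lo] to [hi] can contribute to x^n. *)
pose lo : int := 1 - (C N)%:Z; pose hi : int := n + (C N)%:Z.
pose r := [seq lo + k%:Z | k <- index_iota 0 `|Num.max hi lo - lo|.+1].
have lo_phi (i : 'I_N) m : m < lo -> phi i m = 0.
  move=> mlo; apply: phiC; have := Cmono i N (ltnW (ltn_ord i)).
  by move: mlo; rewrite /lo; lia.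
have hi_phi (i : 'I_N) m : hi < m -> (phi ^ m) i n = 0.
  move=> mhi; apply: (phiXC m); have := Cmono i N (ltnW (ltn_ord i)).
  by move: mhi; rewrite /hi; lia.
transitivity (\sum_(i < N) \sum_(i' < N) (g ^+ i) k * (g ^+ i') j *
    \sum_(l \in [set: nat]) phi l n * (F ^+ l) i i').
  rewrite (@fsum_seq _ _ r).
  - have termE m : associate_twist phi g k m * (associate_twist phi g ^ m) j n =
        \sum_(i < N) \sum_(i' < N) (g ^+ i) k * (g ^+ i') j * (phi i m * (phi ^ m) i' n).
      rewrite (associate_twistXz m g0 phi0) !(@associate_twist_coef _ g g0 _ N) //.
      rewrite mulr_suml; apply: eq_bigr => i _.
      by rewrite mulr_sumr; apply: eq_bigr => i' _; ring.
    under eq_bigr do rewrite termE.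
    rewrite exchange_big; apply: eq_bigr => i _.
    rewrite exchange_big; apply: eq_bigr => i' _.
    rewrite -mulr_sumr; congr (_ * _); apply: associate_twist_unfold => //.
    + by move=> m; exact: lo_phi.
    + by move=> m; exact: hi_phi.
  - by rewrite map_inj_uniq ?iota_uniq // => a b; lia.
  move=> m; rewrite (associate_twistXz m g0 phi0) !(@associate_twist_coef _ g g0 _ N) //.
  have [mlo|lom] := ltP m lo.
    by rewrite big1 ?mul0r ?eqxx // => i _; rewrite lo_phi // mul0r.
  have [him|mhi] := ltP hi m.
    by rewrite mulrC big1 ?mul0r ?eqxx // => i _; rewrite hi_phi // mul0r.
  by move=> _; apply/mapP; exists `|m - lo|%N; rewrite ?mem_index_iota; lia.
(* A power P^l starts in total degree l, and all index sums that occur stay below N + N. *)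
pose L := (N + N)%N.
have Fg00 := fg_twist_coef00 g0 g1 hF.
have F00 : F 0%N 0%N = 0 by rewrite (formal_groupx0 hF).
have cut (P : {fps {fps K}}) b a (f : nat -> K) : P 0%N 0%N = 0 -> (b + a < L)%N ->
    \sum_(l \in [set: nat]) f l * (P ^+ l) b a = \sum_(l < L) f l * (P ^+ l) b a.
  by move=> P0 baL; exact: (@fps_subst2E _ P (Fps f) b a L).
rewrite [RHS]cut //; last by rewrite /L /N; lia.
have -> : \sum_(l < L) associate_twist phi g l n * (fg_twist F g ^+ l) k j =
    \sum_(i < L) phi i n * (subst_both g0 (F ^+ i)) k j.
  under eq_bigr => l _ do rewrite (@associate_twist_coef _ g g0 _ L) // mulr_suml.
  rewrite exchange_big; apply: eq_bigr => i _.
  (* F(g(y), g(z))^i is g^i evaluated at F_g(y, z). *)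
  have -> : subst_both g0 (F ^+ i) = fps_subst2 (fg_twist F g) (g ^+ i).
    rewrite (fps_subst2Xn g i Fg00) (fg_twist_subst g0 g1 hF) fg_subst2E.
    exact: rmorphXn.
  rewrite (@fps_subst2E _ _ _ _ _ L) //; last by rewrite /L /N; lia.
  by rewrite mulr_sumr; apply: eq_bigr => l _; rewrite mulrA.
have -> : \sum_(i < L) phi i n * (subst_both g0 (F ^+ i)) k j =
    \sum_(i < L) \sum_(j' < N) \sum_(i' < N)
       phi i n * ((F ^+ i) j' i' * ((g ^+ i') j * (g ^+ j') k)).
  apply: eq_bigr => i _; rewrite (@subst_both_coef _ _ g0 _ _ _ N) // mulr_sumr.
  by apply: eq_bigr => j' _; rewrite mulr_sumr.
rewrite [RHS]exchange_big; apply: eq_bigr => i _.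
rewrite [RHS]exchange_big; apply: eq_bigr => i' _.
rewrite cut //; last by have := ltn_ord i; have := ltn_ord i'; rewrite /L; lia.
by rewrite mulr_sumr; apply: eq_bigr => l _; ring.
Qed.

End AssociateTwist.

(** * Kernels and convolution *)

Section Kernels.
Variables (K : fieldType) (M : lmodType K).

Lemma kernel_fubini (I J : choiceType) (c : J -> K) (k : J -> I -> K) (s : I -> M)
    (A : set (J * I)) :
  finite_set A ->
  (forall j i, c j != 0 -> k j i != 0 -> s i != 0 -> A (j, i)) ->
  \sum_(j \in [set: J]) c j *: (\sum_(i \in [set: I]) k j i *: s i) =
  \sum_(i \in [set: I]) (\sum_(j \in [set: J]) c j * k j i) *: s i.
Proof.
move=> finA suppA; under eq_fsum do rewrite fsumZ.
rewrite (fsum_exchange finA) => [|j i].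
  apply: eq_fsum => i; rewrite fsumZl.
  by apply: eq_fsum => j; rewrite scalerA.
by rewrite scalerA !scaler_eq0 mulf_eq0 !negb_or -andbA => /and3P[? ? ?]; exact: suppA.
Qed.

(* A substitution sending the monomial of index i to the series with          *)
(* coefficients G i is multiplicative.                                        *)
Lemma kernel_mul (I : zmodType) (G : I -> I -> K) (p : I -> K) (s : I -> M) (a : I)
    (A : set (I * (I * I))) :
  (forall i j, G (i + j) a = \sum_(k \in [set: I]) G i k * G j (a - k)) ->
  finite_set A ->
  (forall k i j, G i k != 0 -> G j (a - k) != 0 -> p i != 0 -> s j != 0 ->
     A (k, (i, j))) ->
  \sum_(c \in [set: I]) G c a *: (\sum_(i \in [set: I]) p i *: s (c - i)) =
  \sum_(k \in [set: I]) (\sum_(i \in [set: I]) G i k *: (p i : K^o)) *: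
    (\sum_(j \in [set: I]) G j (a - k) *: s j).
Proof.
move=> GD finA suppA.
(* Reindexes a pair of exponents (i, j), of p and of s, by the exponent i + j of the product
   together with i. *)
pose h (x : I * I) : I * I := (x.1 + x.2, x.1).
have hbij : bijective h.
  by exists (fun y : I * I => (y.2, y.1 - y.2)) => -[x y]; rewrite /h /= addrC ?addKr // subrK.
have suppP i j : G (i + j) a != 0 -> p i != 0 -> s j != 0 ->
    exists k, A (k, (i, j)).
  rewrite GD => /fsum_neq0[k]; rewrite mulf_eq0 negb_or => /andP[? ?] ? ?.
  by exists k; exact: suppA.
pose A' := [set h q.2 | q in A].
have finA' : finite_set A' by exact: finite_image.
transitivity (\sum_(x \in [set: I * I]) (G x.1 a * p x.2) *: s (x.1 - x.2)).
  rewrite (@fsum_fubini _ _ _ (fun c i => (G c a * p i) *: s (c - i)) A') //.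
    by apply: eq_fsum => c; rewrite fsumZ; apply: eq_fsum => i; rewrite scalerA.
  move=> c i; rewrite scaler_eq0 mulf_eq0 !negb_or -andbA => /and3P[Gc pi sci].
  have [|k Ak] := @suppP i (c - i) _ pi sci; first by rewrite addrC subrK.
  by exists (k, (i, c - i)); rewrite // /h /= addrC subrK.
rewrite (reindex_fsbigT h) //=.
transitivity (\sum_(x \in [set: I * I]) \sum_(k \in [set: I])
    (G x.1 k * G x.2 (a - k) * p x.1) *: s x.2).
  apply: eq_fsum => -[i j] /=; rewrite GD [i + j]addrC addrK.
  by rewrite fsumMl fsumZl.
pose B := [set (q.2, q.1) | q in A].
have finB : finite_set B by exact: finite_image.
rewrite (fsum_exchange finB) => [|[i j] k]; last first.
  rewrite scaler_eq0 !mulf_eq0 !negb_or -!andbA => /and4P[Gi Gj pi sj].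
  by exists (k, (i, j)) => //; exact: suppA.
apply: eq_fsum => k.
pose C := [set q.2 | q in A].
have finC : finite_set C by exact: finite_image.
rewrite (@fsum_fubini _ _ _ (fun i j => (G i k * G j (a - k) * p i) *: s j) C) //; last first.
  move=> i j; rewrite scaler_eq0 !mulf_eq0 !negb_or -!andbA => /and4P[Gi Gj pi sj].
  by exists (k, (i, j)) => //; exact: suppA.
rewrite fsumZl; apply: eq_fsum => i; rewrite fsumZ; apply: eq_fsum => j.
by rewrite !scalerA; congr (_ *: _); rewrite mulrAC.
Qed.

End Kernels.

Lemma uniform_bound (P : int -> int -> Prop) :
  (forall i, exists B : int, forall n, n < B -> P i n) ->
  forall lo hi : int, exists B : int,
    forall i, lo <= i <= hi -> forall n, n < B -> P i n.
Proof.
move=> bnd lo hi.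
have key (d : nat) : exists B : int,
    forall i, lo <= i < lo + d%:Z -> forall n, n < B -> P i n.
  elim: d => [|d [B IH]]; first by exists 0 => i; rewrite addr0; lia.
  have [B' B'P] := bnd (lo + d%:Z).
  exists (Num.min B B') => i iP n; rewrite lt_min => /andP[nB nB'].
  have [->|id] := eqVneq i (lo + d%:Z); first exact: B'P.
  by apply: IH nB; move: iP id; rewrite intS; lia.
have [B BP] := key `|hi - lo|.+1%N.
by exists B => i iP; apply: BP; move: iP; lia.
Qed.

Definition int_box (L : nat) : set (int * int) :=
  [set x | [/\ `|x.1| <= L%:Z & `|x.2| <= L%:Z]].

Lemma finite_int_box L : finite_set (int_box L).
Proof.
apply: sub_finite_set (finite_setX (finite_int_range (- L%:Z) L%:Z) (finite_int_range (- L%:Z) L%:Z)).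
by move=> [x y] [/= xL yL]; split => /=; lia.
Qed.

(** * Coordinated modules *)

Definition x_truncated (M : nmodType) (s : series2 M) :=
  exists N : int, forall a b, a < N -> s a b = 0.

(* s(g(x1), x2) *)
Definition subst_g1 (K : fieldType) (g : {fps K}) (M : lmodType K)
    (s : series2 M) : series2 M :=
  fun a b => \sum_(m \in [set: int]) gamma g m a *: s m b.

Section SubstG1.
Variables (K : fieldType) (g : {fps K}).
Hypotheses (g0 : g 0%N = 0) (g1 : g 1%N = 1).
Variable M : lmodType K.
Implicit Types s : series2 M.

Lemma subst_g1_supp s (N : int) a b m : (forall a b, a < N -> s a b = 0) ->
  gamma g m a *: s m b != 0 -> N <= m <= a.
Proof.
move=> sN; rewrite scaler_eq0 negb_or => /andP[/(gamma_neq0 g0 g1) -> smb].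
by rewrite andbT leNgt; apply: contraNN smb => /sN ->.
Qed.

Lemma subst_g1_diag s a b : x_truncated s ->
  subst_g1 g s a b =
  s a b + \sum_(m \in [set: int]) (if m == a then 0 else gamma g m a *: s m b).
Proof.
move=> [N sN]; pose d m := if m == a then gamma g m a *: s m b else 0.
have -> : s a b = \sum_(m \in [set: int]) d m.
  rewrite (@fsum_one _ _ a); first by rewrite /d eqxx gamma_diag // scale1r.
  by move=> m /negPf ma; rewrite /d ma.
rewrite -(fsumD (finite_int_range N a)).
- by apply: eq_fsum => m; rewrite /d; case: (m =P a); rewrite ?addr0 ?add0r.
- move=> m; rewrite /d; case: (m =P a) => _; last by rewrite eqxx.
  by move=> /(subst_g1_supp sN).
move=> m; case: (m =P a) => _; first by rewrite eqxx.
by move=> /(subst_g1_supp sN).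
Qed.

(** By unitriangularity, row a of the image is row a of s plus a combination of earlier rows. Both
    series start at a common degree L, so the rows are recovered by induction from L upwards. *)
Lemma subst_g1_inj s s' : x_truncated s -> x_truncated s' ->
  subst_g1 g s = subst_g1 g s' -> s = s'.
Proof.
move=> [N sN] [N' sN'] e; pose L := Num.min N N'.
suff : forall (d : nat) a b, a < L + d%:Z -> s a b = s' a b.
  move=> H; apply/funext => a; apply/funext => b; apply: (H `|a - L|.+1%N).
  by rewrite intS; lia.
elim=> [|d IH] a b aL.
  by move: aL; rewrite addr0 lt_min => /andP[? ?]; rewrite sN ?sN'.
have := congr1 (fun f : series2 M => f a b) e.
rewrite !subst_g1_diag; [|by exists N'|by exists N].
have -> : \sum_(m \in [set: int]) (if m == a then 0 else gamma g m a *: s m b) =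
    \sum_(m \in [set: int]) (if m == a then 0 else gamma g m a *: s' m b).
  apply: eq_fsum => m; case: eqP => // /eqP ma.
  have [am|] := ltP a m; first by rewrite gamma_lt // !scale0r.
  by move=> lema; rewrite IH //; move: aL ma lema; rewrite intS; lia.
exact: addIr.
Qed.

Lemma subst_g1_0 : subst_g1 g (fun _ _ => 0) = (fun _ _ => 0) :> series2 M.
Proof.
apply/funext => a; apply/funext => b; apply: fsbig1 => m _; exact: scaler0.
Qed.

(** The substitution (x1, x2) -> (g(x1), x2) as a kernel on pairs of exponents, the form required by
    [kernel_mul]. *)
Definition kernel_g1 (i k : int * int) : K := gamma g i.1 k.1 * (i.2 == k.2)%:R.

Lemma kernel_g1D i j a :
  kernel_g1 (i + j) a =
  \sum_(k \in [set: int * int]) kernel_g1 i k * kernel_g1 j (a - k).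
Proof.
case: i j a => [i1 i2] [j1 j2] [a1 a2].
rewrite (@fsum_fubini _ _ _ (fun k1 k2 => kernel_g1 (i1, i2) (k1, k2) *
  kernel_g1 (j1, j2) ((a1, a2) - (k1, k2)))
  ([set n : int | i1 <= n <= a1 - j1] `*` [set n : int | i2 <= n <= i2])).
- rewrite /kernel_g1 /= (gammaD g0 g1) fsumMl; apply: eq_fsum => k1.
  rewrite (@fsum_one _ _ i2) ?eqxx ?mulr1.
    rewrite mulrA; congr (_ * _%:R); congr nat_of_bool.
    by apply/eqP/eqP; lia.
  by move=> k2 k2i; rewrite eq_sym (negPf k2i) mulr0 mul0r.
- by apply: finite_setX; exact: finite_int_range.
move=> k1 k2; rewrite /kernel_g1 /= !mulf_eq0 !negb_or.
move=> /andP[/andP[/(gamma_neq0 g0 g1) ? e] /andP[/(gamma_neq0 g0 g1) ? _]].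
by split; [lia|move: e; case: (i2 =P k2) => [->|]; rewrite ?eqxx //= lexx].
Qed.

Lemma kernel_g1E s a b : x_truncated s ->
  \sum_(m \in [set: int * int]) kernel_g1 m (a, b) *: s m.1 m.2 = subst_g1 g s a b.
Proof.
move=> [N sN].
rewrite (@fsum_fubini _ _ _ (fun m n => kernel_g1 (m, n) (a, b) *: s m n)
  ([set n : int | N <= n <= a] `*` [set n : int | b <= n <= b])).
- apply: eq_fsum => m; rewrite (@fsum_one _ _ b).
    by rewrite /kernel_g1 /= eqxx mulr1.
  by move=> n nb; rewrite /kernel_g1 /= (negPf nb) mulr0 scale0r.
- by apply: finite_setX; exact: finite_int_range.
move=> m n; rewrite /kernel_g1 /=; case: (n =P b) => [->|_]; last by rewrite mulr0 scale0r eqxx.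
by rewrite mulr1 => /(subst_g1_supp sN) ?; split; rewrite //= lexx.
Qed.

End SubstG1.

Section SubstG1Mul.
Variables (K : fieldType) (g : {fps K}).
Hypotheses (g0 : g 0%N = 0) (g1 : g 1%N = 1).
Variable M : lmodType K.

Lemma mul2_truncated (p : series2 K) (s : series2 M) N L :
  (forall a b, a < N -> p a b = 0) -> (forall a b, a < L -> s a b = 0) ->
  forall a b, a < N + L -> mul2 p s a b = 0.
Proof.
move=> pN sL a b aNL; apply: fsbig1 => -[i j] _ /=.
have [/pN ->|Ni] := ltP i N; first by rewrite scale0r.
by rewrite sL ?scaler0 //; lia.
Qed.

Lemma subst_g1_mul2 (p : series2 K) (s : series2 M) :
  x_truncated p -> (forall a, lower_truncated (p a)) ->
  x_truncated s -> (forall a, lower_truncated (s a)) ->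
  subst_g1 g (mul2 p s) = mul2 (subst_g1 g (p : series2 K^o)) (subst_g1 g s).
Proof.
move=> [N pN] py [L sL] sy; apply/funext => a; apply/funext => b.
rewrite -(kernel_g1E g0 g1); last first.
  by exists (N + L) => ? ?; exact: mul2_truncated.
(* Only rows N to a - L of p and rows L to a - N of s contribute. These are finitely many, so their
   lower bounds in x2 can be made uniform. *)
have [B Bp] := uniform_bound py N (a - L).
have [D Ds] := uniform_bound sy L (a - N).
pose S := (`|a| + `|b| + `|N| + `|L| + `|B| + `|D|)%N.
rewrite (@kernel_mul _ _ _ (kernel_g1 g) (fun i => p i.1 i.2) (fun j => s j.1 j.2) (a, b)
  (int_box S `*` (int_box S `*` int_box S))).
- apply: eq_fsum => -[k l] /=.
  rewrite (kernel_g1E g0 g1 (s := p : series2 K^o)); last by exists N.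
  by rewrite (kernel_g1E g0 g1); last by exists L.
- by move=> i j; exact: kernel_g1D.
- by do !apply: finite_setX; exact: finite_int_box.
move=> [k1 k2] [i1 i2] [j1 j2]; rewrite /kernel_g1 /= !mulf_eq0 !negb_or.
move=> /andP[/(gamma_neq0 g0 g1) ik e1] /andP[/(gamma_neq0 g0 g1) jk e2] p0 s0.
have {}e1 : i2 = k2 by move: e1; case: (i2 =P k2); rewrite ?eqxx.
have {}e2 : j2 = b - k2 by move: e2; case: (j2 =P b - k2); rewrite ?eqxx.
have Ni : N <= i1 by rewrite leNgt; apply: contraNN p0 => /pN ->.
have Lj : L <= j1 by rewrite leNgt; apply: contraNN s0 => /sL ->.
have Bi : B <= i2.
  by rewrite leNgt; apply: contraNN p0 => /Bp -> //; lia.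
have Dj : D <= j2.
  by rewrite leNgt; apply: contraNN s0 => /Ds -> //; lia.
by rewrite /S; split; [|split]; split => /=; lia.
Qed.

End SubstG1Mul.

Lemma linear_morph (K : pzRingType) (U W : lmodType K) (h : U -> W) : linear h ->
  [/\ h 0 = 0, {morph h : x y / x + y} & forall c x, h (c *: x) = c *: h x].
Proof.
move=> lin; pose f : {linear U -> W} := HB.pack h (GRing.isLinear.Build K U W *:%R h lin).
split; first exact: (linear0 f).
  exact: (linearD f).
exact: (linearZ_LR f).
Qed.

(** * The substitution x0 -> g(x0) in the module identity *)

Section ModuleTwist.
Variables (K : fieldType) (g : {fps K}) (phi : {fps {laurent K}}).
Hypotheses (g0 : g 0%N = 0) (g1 : g 1%N = 1) (phi0 : phi 0%N = laurentX K).

Let phig := associate_twist phi g.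

Lemma pow_assoc_neg (psi : {fps {laurent K}}) m a b : a < 0 -> pow_assoc psi m a b = 0.
Proof. by case: a. Qed.

(** Substituting g(x0) is a ring homomorphism, hence commutes with taking the m-th power of phi,
    negative m included. *)
Lemma pow_assoc_twist m a b :
  \sum_(c \in [set: int]) gamma g c a * pow_assoc phi m c b = pow_assoc phig m a b.
Proof.
have [a_neg|] := ltP a 0.
  rewrite pow_assoc_neg //; apply: fsbig1 => c _; have [ac|ca] := ltP a c.
    by rewrite gamma_lt // mul0r.
  by rewrite pow_assoc_neg ?mulr0 //; exact: le_lt_trans ca _.
case: a => // a _.
have -> : pow_assoc phig m a b = \sum_(i < a.+1) (phi ^ m) i b * (g ^+ i) a.
  by rewrite /pow_assoc /swap2 /= /phig (associate_twistXz m g0 phi0) (@associate_twist_coef _ g g0 _ a.+1).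
rewrite (@fsum_seq _ _ (map Posz (index_iota 0 a.+1))).
- rewrite big_map big_mkord; apply: eq_bigr => i _.
  by rewrite gamma_nat // mulrC.
- by rewrite map_inj_uniq ?iota_uniq // => ? ? [].
case=> [c|c]; last by rewrite pow_assoc_neg // mulr0 eqxx.
rewrite mulf_eq0 negb_or => /andP[/(gamma_neq0 g0 g1) ca _].
by apply: map_f; rewrite mem_index_iota; lia.
Qed.

Lemma pow_assoc_bound : exists C : int -> int, (forall a a', a <= a' -> C a <= C a') /\
  forall m a b, pow_assoc phi m a b != 0 -> 0 <= a /\ m - C a <= b.
Proof.
have [C [CD Cmono phiC]] := bounded_polesP phi0.
exists (fun a : int => (C `|Num.max a 0|%N)%:Z); split.
  by move=> a a' aa'; rewrite lez_nat; apply: Cmono; lia.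
move=> m [a|a] b; last by rewrite eqxx.
move=> /= nz; split => //.
rewrite leNgt; apply: contraNN nz => lt; rewrite /pow_assoc /swap2 /=.
have phiXC := bounded_polesXz CD phi0 phiC; apply/eqP; apply: (phiXC m).
exact: lt.
Qed.

(** The double sum is finite because s is bounded below in both variables: for exponents c <= a of
    x0 the pole bound gives m + n <= b + C(a). *)
Lemma subst_g1_pow_assoc (M : lmodType K) (s : series2 M) : lower_truncated2 s ->
  subst_g1 g (subst_x1 (pow_assoc phi) s) = subst_x1 (pow_assoc phig) s.
Proof.
move=> [N sN]; apply/funext => a; apply/funext => b.
have [C [Cmono phiC]] := pow_assoc_bound.
pose S := (`|a| + `|b| + `|N| + `|C a|)%N.
rewrite /subst_g1 /subst_x1.
rewrite (@kernel_fubini _ _ _ _ _ (fun c (mn : int * int) => pow_assoc phi mn.1 c (b - mn.2))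
  (fun mn => s mn.1 mn.2) ([set n : int | 0 <= n <= a] `*` int_box S)).
- by apply: eq_fsum => mn; rewrite pow_assoc_twist.
- by apply: finite_setX; [exact: finite_int_range|exact: finite_int_box].
move=> c [m n] /= /(gamma_neq0 g0 g1) ca /phiC[c0 cb] s0.
have CC := Cmono _ _ ca.
have Nm : N <= m by rewrite leNgt; apply: contraNN s0 => mN; rewrite sN ?mN.
have Nn : N <= n by rewrite leNgt; apply: contraNN s0 => mN; rewrite sN ?mN ?orbT.
by rewrite /S; split; [|split] => /=; lia.
Qed.

Lemma qseries_truncated (q : {fps {fps K}}) : lower_truncated2 (qseries q : series2 K^o).
Proof.
exists 0 => a [b|b] // /orP[a0|//].
exact: (laurent_of_fps_neg (q b) a0).
Qed.

Lemma qsubst_twist q : subst_g1 g (qsubst phi q : series2 K^o) = qsubst phig q.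
Proof. exact: (@subst_g1_pow_assoc K^o (qseries q) (qseries_truncated q)). Qed.

Lemma subst_x1_assoc_neg (psi : {fps {laurent K}}) (M : lmodType K) (s : series2 M) a b :
  a < 0 -> subst_x1 (pow_assoc psi) s a b = 0.
Proof.
by move=> a0; apply: fsbig1 => mn _; rewrite pow_assoc_neg // scale0r.
Qed.

Lemma qsubst_truncated q a : lower_truncated (qsubst phi q a).
Proof.
have [C [Cmono phiC]] := pow_assoc_bound.
have [N qN] := qseries_truncated q.
exists (N + N - C a) => b bC; apply: fsbig1 => -[m n] _.
apply/eqP; apply: contraT; move=> nz.
have : pow_assoc phi m a (b - n) * qseries q m n != 0 := nz.
rewrite mulf_eq0 negb_or => /andP[/phiC[_ cb] q0].
have Nm : N <= m by rewrite leNgt; apply: contraNN q0 => mN; rewrite qN ?mN.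
have Nn : N <= n by rewrite leNgt; apply: contraNN q0 => mN; rewrite qN ?mN ?orbT.
lia.
Qed.

Variables (V W : lmodType K) (Y : V -> V -> int -> V) (one : V) (YW : V -> W -> int -> W).
Hypothesis Ytrunc : forall u v, lower_truncated (Y u v).

Lemma subst_g1_iter u v w : bilinear_modes YW ->
  subst_g1 g (iter_modes Y YW u v w) = iter_modes (vo_twist Y g) YW u v w.
Proof.
move=> [YWl _]; apply/funext => a; apply/funext => b.
have [N YN] := Ytrunc u v.
have [h0 hD hZ] := linear_morph (YWl w b).
rewrite /iter_modes /vo_twist.
rewrite (morph_fsum h0 hD (finite_int_range N a)).
  by apply: eq_fsum => m; rewrite hZ.
move=> m; rewrite scaler_eq0 negb_or => /andP[/(gamma_neq0 g0 g1) ma Y0] /=.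
by rewrite ma andbT leNgt; apply: contraNN Y0 => /YN ->.
Qed.

Lemma iter_modes_truncated u v w : bilinear_modes YW ->
  x_truncated (iter_modes Y YW u v w).
Proof.
move=> [YWl _]; have [N YN] := Ytrunc u v.
exists N => a b aN; rewrite /iter_modes YN //.
by have [] := linear_morph (YWl w b).
Qed.

(** With q fixed, both sides of the twisted identity are the images under [subst_g1] of the two
    sides for phi, and q(phi(x2, g(x0)), x2) is the image of q(phi(x2, x0), x2). Injectivity then
    gives the identity and the nonvanishing condition in both directions; the truncation condition
    on q Y_W Y_W involves neither phi nor Y. *)
Lemma coordinated_module_twist (Q : set {fps {fps K}}) :
  coordinated_module_for Q phi Y one YW <->
  coordinated_module_for Q phig (vo_twist Y g) one YW.
Proof.
have key (lin : bilinear_modes YW) (tr : forall v w, lower_truncated (YW v w)) q u v w :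
    lower_truncated2 (mul2 (qseries q) (comp_modes YW u v w)) ->
  let lhs psi := subst_x1 (pow_assoc psi) (mul2 (qseries q) (comp_modes YW u v w)) in
  let rhs psi Y' := mul2 (qsubst psi q) (iter_modes Y' YW u v w) in
  lhs phi = rhs phi Y <-> lhs phig = rhs phig (vo_twist Y g).
  move=> mtr lhs rhs.
  have itr := iter_modes_truncated u v w lin.
  have qtr : x_truncated (qsubst phi q : series2 K^o).
    by exists 0 => a b; exact: subst_x1_assoc_neg.
  have -> : lhs phig = subst_g1 g (lhs phi) by rewrite subst_g1_pow_assoc.
  have -> : rhs phig (vo_twist Y g) = subst_g1 g (rhs phi Y).
    rewrite /rhs (subst_g1_mul2 g0 g1) //.
    - by rewrite qsubst_twist subst_g1_iter.
    - exact: qsubst_truncated.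
    by move=> a; exact: tr.
  split=> [-> //|]; apply: (subst_g1_inj g0 g1).
    by exists 0 => a b; exact: subst_x1_assoc_neg.
  have [[N qN] [L iL]] := (qtr, itr).
  by exists (N + L) => a b; exact: mul2_truncated.
have qkey q : qsubst phi q <> (fun _ _ => 0) <-> qsubst phig q <> (fun _ _ => 0).
  rewrite -qsubst_twist; split; apply: contra_not => e.
    apply: (@subst_g1_inj K g g0 g1 K^o).
    - by exists 0 => a b; exact: subst_x1_assoc_neg.
    - by exists 0.
    by rewrite e subst_g1_0.
  by rewrite e; exact: (@subst_g1_0 K g K^o).
split=> -[lin tr vac asso].
  split; [exact: lin|exact: tr|exact: vac|move=> u v].
  have [q [Qq q0 mtr e]] := asso u v; exists q.
  split; [exact: Qq|exact: (qkey q).1 q0|exact: mtr|move=> w].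
  exact: (key lin tr q u v w (mtr w)).1 (e w).
split; [exact: lin|exact: tr|exact: vac|move=> u v].
have [q [Qq q0 mtr e]] := asso u v; exists q.
split; [exact: Qq|exact: (qkey q).2 q0|exact: mtr|move=> w].
exact: (key lin tr q u v w (mtr w)).2 (e w).
Qed.

End ModuleTwist.

(** * Simultaneous change of both variables *)

Section Quadrants.
Variables (K : fieldType) (M : lmodType K).
Implicit Types (p q : series2 K) (s : series2 M).

(** Substituting g and multiplying by power series only raise exponents, so a coefficient of the
    result depends on a lower left quadrant of s. Finite support there makes the defining sums
    finite. *)
Definition quadrant_finite s := forall a b : int, exists L : nat,
  forall m n, m <= a -> n <= b -> s m n != 0 -> `|m| <= L%:Z /\ `|n| <= L%:Z.

Definition first_quadrant p := forall a b, p a b != 0 -> 0 <= a /\ 0 <= b.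

Lemma quadrant_finite_cols s N : (forall a b, b < N -> s a b = 0) ->
  (forall b, exists B : int, forall a, a < B -> s a b = 0) -> quadrant_finite s.
Proof.
move=> sN sB a b; have [B BP] := uniform_bound sB N b.
exists (`|a| + `|b| + `|N| + `|B|)%N => m n ma nb s0.
have Nn : N <= n by rewrite leNgt; apply: contraNN s0 => /sN ->.
have Bm : B <= m by rewrite leNgt; apply: contraNN s0 => /BP -> //; lia.
by split; lia.
Qed.

Lemma quadrant_finite_rows s N : (forall a b, a < N -> s a b = 0) ->
  (forall a, lower_truncated (s a)) -> quadrant_finite s.
Proof.
move=> sN sB a b; have [B BP] := uniform_bound sB N a.
exists (`|a| + `|b| + `|N| + `|B|)%N => m n ma nb s0.
have Nn : N <= m by rewrite leNgt; apply: contraNN s0 => /sN ->.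
have Bm : B <= n by rewrite leNgt; apply: contraNN s0 => /BP -> //; lia.
by split; lia.
Qed.

Lemma mul2A p q s : first_quadrant p -> first_quadrant q -> quadrant_finite s ->
  mul2 p (mul2 q s) = mul2 (mul2 p (q : series2 K^o)) s.
Proof.
move=> p0 q0 sfin; apply/funext => a; apply/funext => b.
have [L LP] := sfin a b; pose S := (`|a| + `|b| + L)%N.
transitivity (\sum_(i \in [set: int * int]) p i.1 i.2 *:
    \sum_(k \in [set: int * int]) q (k - i).1 (k - i).2 *: s (a - k.1) (b - k.2)).
  apply: eq_fsum => -[i1 i2] /=; congr (_ *: _).
  rewrite [LHS](reindex_fsbigT (fun k : int * int => k - (i1, i2))); last first.
    by exists (fun k => k + (i1, i2)) => k; rewrite ?subrK ?addrK.
  apply: eq_fsum => -[k1 k2] /=; congr (_ *: s _ _); lia.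
rewrite (@kernel_fubini _ _ _ _ (fun i => p i.1 i.2) (fun i k => q (k - i).1 (k - i).2)
  (fun k => s (a - k.1) (b - k.2)) (int_box S `*` int_box S)) //.
  by apply: finite_setX; exact: finite_int_box.
move=> [i1 i2] [k1 k2] /= /p0[? ?] /q0 /= [? ?] /LP h.
have [||? ?] := h; [lia|lia|].
by rewrite /S; split; split => /=; lia.
Qed.

Lemma pow_fg_neq0 (P : {fps {fps K}}) m a b : P 0%N = fpsX K ->
  pow_fg P m a b != 0 -> 0 <= b /\ m <= a + b.
Proof.
move=> P0; case: b => [b|b]; last by rewrite eqxx.
move=> pw; split=> //; rewrite leNgt; apply: contraNN pw => lt; apply/eqP.
by apply: (@embed2Xz_poles K P m P0); lia.
Qed.

Lemma subst_x1_fg_supp (P : {fps {fps K}}) s N a b m n : P 0%N = fpsX K ->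
  (forall a b, b < N -> s a b = 0) ->
  pow_fg P m a (b - n) != 0 -> s m n != 0 ->
  [/\ N <= n, n <= b & m <= a + (b - n)].
Proof.
move=> P0 sN /(pow_fg_neq0 P0)[? ?] s0; split=> //; last by lia.
by rewrite leNgt; apply: contraNN s0 => /sN ->.
Qed.

(** A term x1^m x2^n reaches x0^a x2^b only if N <= n <= b and m <= a + b - n, and s has finitely
    many terms in that range. *)
Lemma subst_x1_fg_finite (P : {fps {fps K}}) s N : P 0%N = fpsX K ->
  (forall a b, b < N -> s a b = 0) -> quadrant_finite s ->
  quadrant_finite (subst_x1 (pow_fg P) s).
Proof.
move=> P0 sN sfin a b; have [L LP] := sfin (a + b - N) b.
exists (`|a| + `|b| + L + L)%N => a' b' a'a b'b /fsum_neq0[[m n] /=].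
rewrite scaler_eq0 negb_or => /andP[pw s0].
have [? ? ?] := subst_x1_fg_supp P0 sN pw s0.
have [||? ?] := LP m n _ _ s0; [lia|lia|by split; lia].
Qed.

End Quadrants.

Lemma qseries_quadrant (K : fieldType) (P : {fps {fps K}}) : first_quadrant (qseries P).
Proof.
move=> a [b|b]; last by rewrite eqxx.
move=> nz; split=> //; rewrite leNgt; apply: contraNN nz => a0.
by apply/eqP; exact: (laurent_of_fps_neg (P b) a0).
Qed.

Arguments qseries : simpl never.

Lemma qseries_nat (K : fieldType) (P : {fps {fps K}}) (a b : nat) : qseries P a b = P b a.
Proof. exact: laurent_of_fps_coef. Qed.

Lemma qseriesM (K : fieldType) (P Q : {fps {fps K}}) :
  qseries (P * Q) = mul2 (qseries P) (qseries Q : series2 K^o).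
Proof.
apply/funext => a; apply/funext => b.
have supp i : qseries P i.1 i.2 *: (qseries Q (a - i.1) (b - i.2) : K^o) != 0 ->
    [/\ 0 <= i.1 <= a & 0 <= i.2 <= b].
  move=> nz; have : qseries P i.1 i.2 * qseries Q (a - i.1) (b - i.2) != 0 := nz.
  rewrite mulf_eq0 negb_or => /andP[/qseries_quadrant[? ?] /qseries_quadrant[? ?]].
  by split; lia.
have [/andP[a0 b0]|neg] := boolP ((0 <= a) && (0 <= b)); last first.
  rewrite [RHS]fsbig1; last first.
    move=> i _; apply/eqP; apply: contraNT neg => /supp[]; lia.
  by apply/eqP; apply: contraNT neg => /qseries_quadrant[-> ->].
case: a b a0 b0 supp => // a [] // b _ _ supp.
rewrite qseries_nat fps_coefM fps_coef_sum.
rewrite [RHS](@fsum_seq _ _ [seq (Posz i, Posz j) | j <- index_iota 0 b.+1, i <- index_iota 0 a.+1]).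
- rewrite big_allpairs_dep big_mkord; apply: eq_bigr => j _.
  rewrite big_mkord fps_coefM; apply: eq_bigr => i _ /=.
  rewrite qseries_nat.
  have -> : a%:Z - i%:Z = (a - i)%N%:Z by have := ltn_ord i; lia.
  have -> : b%:Z - j%:Z = (b - j)%N%:Z by have := ltn_ord j; lia.
  by rewrite qseries_nat.
- by apply: allpairs_uniq; rewrite ?iota_uniq // => -[j i] [j' i'] _ _ /= [-> ->].
move=> [i j] /supp[ia jb]; rewrite [i in (i, _)](_ : i = `|i|%N) 1?[j](_ : j = `|j|%N).
- by apply: (@allpairs_f _ _ _ (fun j i => (Posz i, Posz j))); rewrite mem_index_iota; move: ia jb => /=; lia.
- by move: jb => /=; lia.
by move: ia => /=; lia.
Qed.

Section SubstG2.
Variables (K : fieldType) (g : {fps K}).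
Hypotheses (g0 : g 0%N = 0) (g1 : g 1%N = 1).

Definition kernel_g2 (i k : int * int) : K := gamma g i.1 k.1 * gamma g i.2 k.2.

(* s(g(x1), g(x2)) *)
Definition subst_g2 (M : lmodType K) (s : series2 M) : series2 M :=
  fun a b => \sum_(i \in [set: int * int]) kernel_g2 i (a, b) *: s i.1 i.2.

Lemma kernel_g2_neq0 i k : kernel_g2 i k != 0 -> i.1 <= k.1 /\ i.2 <= k.2.
Proof.
by rewrite mulf_eq0 negb_or => /andP[/(gamma_neq0 g0 g1) ? /(gamma_neq0 g0 g1) ?].
Qed.

Lemma kernel_g2D i j a :
  kernel_g2 (i + j) a =
  \sum_(k \in [set: int * int]) kernel_g2 i k * kernel_g2 j (a - k).
Proof.
case: i j a => [i1 i2] [j1 j2] [a1 a2].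
rewrite (@fsum_fubini _ _ _ (fun k1 k2 => kernel_g2 (i1, i2) (k1, k2) *
  kernel_g2 (j1, j2) ((a1, a2) - (k1, k2)))
  ([set n : int | i1 <= n <= a1 - j1] `*` [set n : int | i2 <= n <= a2 - j2])).
- rewrite /kernel_g2 /= !(gammaD g0 g1) fsumMl; apply: eq_fsum => k1.
  by rewrite fsumMr; apply: eq_fsum => k2; ring.
- by apply: finite_setX; exact: finite_int_range.
move=> k1 k2; rewrite mulf_eq0 negb_or.
by move=> /andP[/kernel_g2_neq0/= [? ?] /kernel_g2_neq0/= [? ?]]; split => /=; lia.
Qed.

Lemma subst_g2_mul2 (M : lmodType K) (p : series2 K) (s : series2 M) :
  first_quadrant p -> quadrant_finite s ->
  subst_g2 (mul2 p s) = mul2 (subst_g2 (p : series2 K^o)) (subst_g2 s).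
Proof.
move=> p0 sfin; apply/funext => a; apply/funext => b.
have [L LP] := sfin a b; pose S := (`|a| + `|b| + L)%N.
rewrite [LHS](@kernel_mul _ _ _ kernel_g2 (fun i => p i.1 i.2) (fun j => s j.1 j.2) (a, b)
  (int_box S `*` (int_box S `*` int_box S))) //.
- by move=> i j; exact: kernel_g2D.
- by do !apply: finite_setX; exact: finite_int_box.
move=> [k1 k2] [i1 i2] [j1 j2] /kernel_g2_neq0/= [? ?] /kernel_g2_neq0/= [? ?].
move=> /p0[? ?] /LP h; have [||? ?] := h; [lia|lia|].
by rewrite /S; split; [|split]; split => /=; lia.
Qed.

(** The kernel form of the substitution serves vector-valued series, the homomorphism form serves
    powers of F; their agreement carries results on powers over to the kernel form. *)
Lemma subst_g2_fps (f : {fps {laurent K}}) a (b : nat) :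
  subst_g2 (to_series2 f : series2 K^o) a b = laurent_subst_both g0 g1 f b a.
Proof.
rewrite laurent_subst_bothE (@associate_twist_coef _ g g0 _ b.+1) //.
have fB d : lower_truncated (fun c => to_series2 f c d).
  by case: d => [d|d]; [exact: laurent_trunc (f d)|exists 0].
have [B BP] := uniform_bound fB 0 b.
pose A := [set n : int | B <= n <= a] `*` [set n : int | 0 <= n <= b%:Z].
have finA : finite_set A by apply: finite_setX; exact: finite_int_range.
have suppA c d :
    kernel_g2 (c, d) (a, b%:Z) *: (to_series2 f c d : K^o) != 0 -> A (c, d).
  move=> nz; have : kernel_g2 (c, d) (a, b%:Z) * to_series2 f c d != 0 := nz.
  rewrite mulf_eq0 negb_or => /andP[/kernel_g2_neq0/= [ca db] f0].
  have d0 : 0 <= d by case: d f0 {nz db} => //= d; rewrite eqxx.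
  split => /=; last by lia.
  by rewrite ca andbT leNgt; apply: contraNN f0 => /BP -> //; lia.
rewrite /subst_g2 (@fsum_fubini _ _ _ (fun c d => kernel_g2 (c, d) (a, b%:Z) *:
  (to_series2 f c d : K^o)) _ finA suppA) (fsum_exchange finA suppA).
rewrite (@fsum_seq _ _ (map Posz (index_iota 0 b.+1))).
- rewrite big_map big_mkord; apply: eq_bigr => d _.
  rewrite fps_map_coef laurent_subst_coef fsumMl; apply: eq_fsum => c.
  by rewrite /kernel_g2 /= gamma_nat //; change (gamma g c a * (g ^+ d) b * f d c = f d c * gamma g c a * (g ^+ d) b); ring.
- by rewrite map_inj_uniq ?iota_uniq // => ? ? [].
move=> d /fsum_neq0[c nz].
have : kernel_g2 (c, d) (a, b%:Z) * to_series2 f c d != 0 := nz.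
rewrite mulf_eq0 negb_or => /andP[/kernel_g2_neq0[_ db'] f0].
have db : d <= b%:Z := db'.
case: d f0 db {nz db'} => [d|d]; last by rewrite eqxx.
by move=> _ db; apply: map_f; rewrite mem_index_iota; lia.
Qed.

Lemma subst_g2_fps_neg (f : {fps {laurent K}}) a b : b < 0 ->
  subst_g2 (to_series2 f : series2 K^o) a b = 0.
Proof.
move=> b0; apply: fsbig1 => -[c d] _; apply/eqP; apply: contraT => nz.
have : kernel_g2 (c, d) (a, b) * to_series2 f c d != 0 := nz.
rewrite mulf_eq0 negb_or => /andP[/kernel_g2_neq0/= [ca db]].
by case: d db {nz} => [d|d] /=; [lia|rewrite eqxx].
Qed.

Lemma subst_g2_qseries P :
  subst_g2 (qseries P : series2 K^o) = qseries (subst_both g0 P).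
Proof.
apply/funext => a; apply/funext => -[b|b]; last exact: subst_g2_fps_neg.
by rewrite subst_g2_fps laurent_subst_both_embed.
Qed.

End SubstG2.

Section SubstFG.
Variables (K : fieldType) (g : {fps K}) (F : {fps {fps K}}).
Hypotheses (g0 : g 0%N = 0) (g1 : g 1%N = 1) (hF : formal_group F).

Let Fg := fg_twist F g.
Let F0 : F 0%N = fpsX K. Proof. exact: formal_groupx0. Qed.
Let Fg0 : Fg 0%N = fpsX K. Proof. exact: fg_twistx0. Qed.

Lemma subst_g2_pow (m a b : int) :
  subst_g2 g (pow_fg F m : series2 K^o) a b =
  \sum_(c \in [set: int]) gamma g m c * pow_fg Fg c a b.
Proof.
case: b => [b|b]; last first.
  rewrite [LHS](subst_g2_fps_neg g0 g1) //; apply/esym/fsbig1 => c _.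
  exact: mulr0.
by rewrite [LHS](subst_g2_fps g0 g1) (laurent_subst_both_pow g0 g1 hF).
Qed.

(** Both sides are the coefficient of x0^a x2^b in F(g(x0), g(x2))^m g(x2)^n; on the right F(g(x0),
    g(x2))^m is expanded as g(F_g(x0, x2))^m. *)
Lemma subst_g2_shift_pow (m n a b : int) :
  \sum_(c \in [set: int * int]) kernel_g2 g c (a, b) * pow_fg F m c.1 (c.2 - n) =
  \sum_(c \in [set: int * int]) pow_fg Fg c.1 a (b - c.2) * kernel_g2 g (m, n) c.
Proof.
(* [p] is the monomial x2^n, so that the shift by n becomes a product to which [kernel_mul]
   applies. *)
pose p (i : int * int) : K := (i == (0, n))%:R.
pose S := (`|a| + `|b| + `|m| + `|n|)%N.
transitivity (\sum_(c \in [set: int * int]) kernel_g2 g c (a, b) *: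
    (\sum_(i \in [set: int * int]) p i *: (pow_fg F m (c - i).1 (c - i).2 : K^o))).
  apply: eq_fsum => c; rewrite (@fsum_one _ _ (0, n)); last first.
    by move=> i /negPf i0; rewrite /p i0 scale0r.
  by rewrite /p eqxx scale1r /= subr0.
rewrite (@kernel_mul _ K^o _ (kernel_g2 g) p (fun j => pow_fg F m j.1 j.2) (a, b)
  (int_box (S + S) `*` (int_box (S + S) `*` int_box (S + S)))); last first.
- move=> [k1 k2] [i1 i2] [j1 j2] /(kernel_g2_neq0 g0 g1)/= [? ?].
  move=> /(kernel_g2_neq0 g0 g1)/= [? ?] pi /(pow_fg_neq0 F0)[? ?].
  have [i10 i2n] : i1 = 0 /\ i2 = n.
    by move: pi; rewrite /p; case: ((i1, i2) =P (0, n)) => [[-> ->]|]; rewrite ?eqxx.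
  by rewrite /S; split; [|split]; split => /=; lia.
- by do !apply: finite_setX; exact: finite_int_box.
- by move=> i j; exact: kernel_g2D.
transitivity (\sum_(k \in [set: int * int])
    (k.1 == 0)%:R * (gamma g n k.2 * subst_g2 g (pow_fg F m : series2 K^o) (a - k.1) (b - k.2))).
  apply: eq_fsum => -[k1 k2]; rewrite (@fsum_one _ _ (0, n)); last first.
    by move=> i /negPf i0; rewrite /p i0 scaler0.
  by rewrite /p eqxx /kernel_g2 /= gamma0 mulrA -[X in X *: _]/(_ * 1) mulr1.
have supp k2 : gamma g n k2 * subst_g2 g (pow_fg F m : series2 K^o) a (b - k2) != 0 ->
    n <= k2 <= b.
  rewrite mulf_eq0 negb_or => /andP[/(gamma_neq0 g0 g1) -> nz] /=.
  rewrite leNgt; apply: contraNN nz => bk; apply/eqP.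
  by apply: (subst_g2_fps_neg g0 g1); lia.
rewrite (@fsum_fubini _ _ _ (fun k1 k2 => (k1 == 0)%:R * (gamma g n k2 *
    subst_g2 g (pow_fg F m : series2 K^o) (a - k1) (b - k2)))
  ([set x : int | 0 <= x <= 0] `*` [set x : int | n <= x <= b])); last 2 first.
- by apply: finite_setX; exact: finite_int_range.
- move=> k1 k2; rewrite mulf_eq0 negb_or => /andP[k10].
  have -> : k1 = 0 by move: k10; case: (k1 =P 0) => // _; rewrite eqxx.
  by rewrite subr0 => /supp ?.
rewrite (@fsum_one _ _ 0); last first.
  by move=> k1 /negPf k10; apply: fsbig1 => k2 _; rewrite k10 mul0r.
transitivity (\sum_(d \in [set: int]) \sum_(c \in [set: int])
    pow_fg Fg c a (b - d) * kernel_g2 g (m, n) (c, d)).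
  apply: eq_fsum => d; rewrite eqxx mul1r subr0 subst_g2_pow fsumMr.
  by apply: eq_fsum => c; rewrite /kernel_g2 /=; ring.
have supp2 c d : pow_fg Fg c a (b - d) * kernel_g2 g (m, n) (c, d) != 0 ->
    m <= c <= a + b - n /\ n <= d <= b.
  rewrite mulf_eq0 negb_or => /andP[/(pow_fg_neq0 Fg0)[? ?]].
  by move=> /(kernel_g2_neq0 g0 g1)/= [? ?]; lia.
rewrite (fsum_exchange (A := [set x : int | n <= x <= b] `*` [set x : int | m <= x <= a + b - n])).
- rewrite -(@fsum_fubini _ _ _ (fun c d => pow_fg Fg c a (b - d) * kernel_g2 g (m, n) (c, d))
    ([set x : int | m <= x <= a + b - n] `*` [set x : int | n <= x <= b])).
  + by apply: eq_fsum => -[].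
  + by apply: finite_setX; exact: finite_int_range.
  by move=> c d /supp2.
- by apply: finite_setX; exact: finite_int_range.
by move=> d c /supp2[? ?].
Qed.

(** On a monomial x1^m x2^n this is [subst_g2_shift_pow]; the bounds on s justify collecting both
    sides monomial by monomial. *)
Lemma subst_g2_fg (M : lmodType K) (s : series2 M) N :
  (forall a b, b < N -> s a b = 0) -> quadrant_finite s ->
  subst_g2 g (subst_x1 (pow_fg F) s) = subst_x1 (pow_fg Fg) (subst_g2 g s).
Proof.
move=> sN sfin; apply/funext => a; apply/funext => b.
have [L LP] := sfin (a + b - N) b.
pose S := (`|a| + `|b| + L + L)%N.
rewrite /subst_g2 /subst_x1.
rewrite (@kernel_fubini _ _ _ _ (fun c => kernel_g2 g c (a, b))
  (fun c i => pow_fg F i.1 c.1 (c.2 - i.2)) (fun i => s i.1 i.2) (int_box S `*` int_box S)); last 2 first.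
- by apply: finite_setX; exact: finite_int_box.
- move=> [c d] [m n] /(kernel_g2_neq0 g0 g1)/= [? ?] pw s0.
  have [? ? ?] := subst_x1_fg_supp F0 sN pw s0.
  have [||? ?] := LP m n _ _ s0; [lia|lia|].
  by rewrite /S; split; split => /=; lia.
rewrite (@kernel_fubini _ _ _ _ (fun c => pow_fg Fg c.1 a (b - c.2))
  (fun c i => kernel_g2 g i c) (fun i => s i.1 i.2) (int_box S `*` int_box S)); last 2 first.
- by apply: finite_setX; exact: finite_int_box.
- move=> [c d] [m n] /= /(pow_fg_neq0 Fg0)[? ?] /(kernel_g2_neq0 g0 g1)/= [? ?] s0.
  have ? : N <= n by rewrite leNgt; apply: contraNN s0 => /sN ->.
  have [||? ?] := LP m n _ _ s0; [lia|lia|].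
  by rewrite /S; split; split => /=; lia.
by apply: eq_fsum => -[m n]; rewrite subst_g2_shift_pow.
Qed.

(* F(g(x), g(y)) = g(F_g(x, y)) is F_g(x, y) times a unit, because g(t) is t  *)
(* times a unit.                                                              *)
Lemma fg_twist_dvd : exists U, Fg = U * fg_subst2 F g.
Proof.
have Fg00 := fg_twist_coef00 g0 g1 hF.
pose u := fps_subst2 Fg (fps_shift g).
have uP : fg_subst2 F g = Fg * u.
  rewrite -(fg_twist_subst g0 g1 hF).
  have gE : g = fpsX K * fps_shift g by rewrite {1}(fps_shiftE g) g0 rmorph0 add0r.
  rewrite [X in fps_subst2 _ X]gE.
  by apply: (eq_trans (fps_subst2M _ _ Fg00)); rewrite (fps_subst2X Fg00).
have u_unit : u \is a GRing.unit.
  have u0 : u 0%N \is a GRing.unit.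
    by apply: (@fps_unit _ _ 1); rewrite mul1r fps_subst2_coef00.
  by apply: (@fps_unit _ _ (u 0%N)^-1); rewrite mulVr.
by exists u^-1; rewrite uP mulrCA mulVr // mulr1.
Qed.

End SubstFG.

(** * Twisted vertex algebras *)

Section VertexTwist.
Variables (K : fieldType) (g : {fps K}) (F : {fps {fps K}}).
Hypotheses (g0 : g 0%N = 0) (g1 : g 1%N = 1) (hF : formal_group F).
Variables (V : lmodType K) (Y : V -> V -> int -> V) (one : V).
Hypothesis hV : nonlocal_vertex_algebra F Y one.

Let Ylin := nva_linear hV.
Let Ytr := nva_trunc hV.
Let Yg := vo_twist Y g.

Let vo_supp u v n m N : (forall m, m < N -> Y u v m = 0) ->
  gamma g m n *: Y u v m != 0 -> N <= m <= n.
Proof.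
move=> YN; rewrite scaler_eq0 negb_or => /andP[/(gamma_neq0 g0 g1) -> Y0].
by rewrite andbT leNgt; apply: contraNN Y0 => /YN ->.
Qed.

Lemma vo_twist_trunc u v : lower_truncated (Yg u v).
Proof.
have [N YN] := Ytr u v; exists N => n nN; apply: fsbig1 => m _.
by apply/eqP; apply: contraT => /(vo_supp YN); lia.
Qed.

Lemma vo_twist_linear : bilinear_modes Yg.
Proof.
have [Yl Yr] := Ylin.
have lin (y y1 y2 : int -> V) c n : (forall m, y m = c *: y1 m + y2 m) ->
    lower_truncated y1 -> lower_truncated y2 ->
    \sum_(m \in [set: int]) gamma g m n *: y m =
    c *: (\sum_(m \in [set: int]) gamma g m n *: y1 m) +
    \sum_(m \in [set: int]) gamma g m n *: y2 m.
  move=> yE [N1 yN1] [N2 yN2]; rewrite fsumZ.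
  rewrite -(fsumD (finite_int_range (Num.min N1 N2) n)).
  - by apply: eq_fsum => m; rewrite yE scalerDr !scalerA [c * _]mulrC.
  - move=> m; rewrite !scaler_eq0 !negb_or => /and3P[_ /(gamma_neq0 g0 g1) mn y0] /=.
    by rewrite mn andbT leNgt; apply: contraNN y0; rewrite lt_min => /andP[/yN1 ->].
  move=> m; rewrite scaler_eq0 negb_or => /andP[/(gamma_neq0 g0 g1) mn y0] /=.
  by rewrite mn andbT leNgt; apply: contraNN y0; rewrite lt_min => /andP[_ /yN2 ->].
split=> [w n|u n] c x y; apply: lin => // m.
- by have [_ hD hZ] := linear_morph (Yl w m); rewrite hD hZ.
- by have [_ hD hZ] := linear_morph (Yr u m); rewrite hD hZ.
Qed.

Lemma comp_modes_cols (Z : V -> V -> int -> V) u v w : bilinear_modes Z ->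
  (forall u v, lower_truncated (Z u v)) ->
  (exists N, forall a b, b < N -> comp_modes Z u v w a b = 0) /\
  (forall b, exists B : int, forall a, a < B -> comp_modes Z u v w a b = 0).
Proof.
move=> [_ Zr] Ztr; split; last by move=> b; exact: Ztr.
have [N ZN] := Ztr v w; exists N => a b bN; rewrite /comp_modes ZN //.
by have [] := linear_morph (Zr u a).
Qed.

Lemma comp_modes_finite (Z : V -> V -> int -> V) u v w : bilinear_modes Z ->
  (forall u v, lower_truncated (Z u v)) -> quadrant_finite (comp_modes Z u v w).
Proof.
move=> Zlin Ztr; have [[N cN] cB] := comp_modes_cols u v w Zlin Ztr.
exact: quadrant_finite_cols cN cB.
Qed.

Lemma iter_modes_finite (Z : V -> V -> int -> V) u v w : bilinear_modes Z ->
  (forall u v, lower_truncated (Z u v)) -> quadrant_finite (iter_modes Z Z u v w).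
Proof.
move=> [Zl _] Ztr; have [N ZN] := Ztr u v.
apply: (@quadrant_finite_rows _ _ _ N) => [a b aN|a]; last exact: Ztr.
by rewrite /iter_modes ZN //; have [] := linear_morph (Zl w b).
Qed.

(** Both orders are used: linearity of Y absorbs the inner sum, which runs over the second exponent
    for Y(u, x1)Y(v, x2)w and over the first for Y(Y(u, x0)v, x2)w. *)
Lemma subst_g2_fubini (M : lmodType K) (s : series2 M) a b : quadrant_finite s ->
  subst_g2 g s a b = \sum_(m \in [set: int]) gamma g m a *:
    \sum_(n \in [set: int]) gamma g n b *: s m n /\
  subst_g2 g s a b = \sum_(n \in [set: int]) gamma g n b *:
    \sum_(m \in [set: int]) gamma g m a *: s m n.
Proof.
move=> sfin; have [L LP] := sfin a b.
have supp m n : kernel_g2 g (m, n) (a, b) *: s m n != 0 -> int_box L (m, n).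
  rewrite scaler_eq0 negb_or => /andP[/(kernel_g2_neq0 g0 g1)/= [ma nb]].
  by move=> /(LP _ _ ma nb)[].
have e : subst_g2 g s a b = \sum_(m \in [set: int]) \sum_(n \in [set: int])
    kernel_g2 g (m, n) (a, b) *: s m n.
  rewrite -(@fsum_fubini _ _ _ (fun m n => kernel_g2 g (m, n) (a, b) *: s m n) (int_box L)).
  - by apply: eq_fsum => -[].
  - exact: finite_int_box.
  exact: supp.
split; rewrite e.
  by apply: eq_fsum => m; rewrite fsumZ; apply: eq_fsum => n; rewrite scalerA.
rewrite (fsum_exchange (finite_int_box L) supp).
apply: eq_fsum => n; rewrite fsumZ; apply: eq_fsum => m.
by rewrite scalerA /kernel_g2 /= mulrC.
Qed.

Lemma subst_g2_comp u v w :
  subst_g2 g (comp_modes Y u v w) = comp_modes Yg u v w.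
Proof.
apply/funext => a; apply/funext => b.
have [-> _] := subst_g2_fubini a b (comp_modes_finite u v w Ylin Ytr).
rewrite /comp_modes /Yg /vo_twist; apply: eq_fsum => m; congr (_ *: _).
have [h0 hD hZ] := linear_morph (Ylin.2 u m).
have [N YN] := Ytr v w.
rewrite (morph_fsum h0 hD (finite_int_range N b)); last by move=> ? /(vo_supp YN).
by apply: eq_fsum => n; rewrite hZ.
Qed.

Lemma subst_g2_iter u v w :
  subst_g2 g (iter_modes Y Y u v w) = iter_modes Yg Yg u v w.
Proof.
apply/funext => a; apply/funext => b.
have [_ ->] := subst_g2_fubini a b (iter_modes_finite u v w Ylin Ytr).
rewrite /iter_modes /Yg /vo_twist; apply: eq_fsum => n; congr (_ *: _).
have [h0 hD hZ] := linear_morph (Ylin.1 w n).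
have [N YN] := Ytr u v.
rewrite (morph_fsum h0 hD (finite_int_range N a)); last by move=> ? /(vo_supp YN).
by apply: eq_fsum => m; rewrite hZ.
Qed.

Lemma pow_fg_qseries (P : {fps {fps K}}) (l : nat) : pow_fg P l = qseries (P ^+ l).
Proof. by rewrite /pow_fg /qseries /embed2 rmorphXn. Qed.

(** Applying [subst_g2] to the identity for F gives the identity for Y_g with the factor F(g(x0),
    g(x2))^l. As F_g = U F(g(x0), g(x2)) for a power series U, multiplying by U^l produces the
    factor F_g^l, with the same l. *)
Lemma vo_twist_assoc u v w : exists l : nat,
  mul2 (pow_fg (fg_twist F g) l) (subst_x1 (pow_fg (fg_twist F g)) (comp_modes Yg u v w)) =
  mul2 (pow_fg (fg_twist F g) l) (iter_modes Yg Yg u v w).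
Proof.
have [l e] := nva_assoc hV u v w; exists l.
have F0 : F 0%N = fpsX K by exact: formal_groupx0 hF.
have Fg0 : fg_twist F g 0%N = fpsX K by exact: fg_twistx0.
have [[N cN] cB] := comp_modes_cols u v w Ylin Ytr.
have cfin := quadrant_finite_cols cN cB.
have [[N' cN'] cB'] := comp_modes_cols u v w vo_twist_linear vo_twist_trunc.
have cfin' := quadrant_finite_cols cN' cB'.
have ifin' := iter_modes_finite u v w vo_twist_linear vo_twist_trunc.
have := congr1 (subst_g2 g (M := V)) e.
rewrite !pow_fg_qseries.
rewrite !(subst_g2_mul2 g0 g1 (@qseries_quadrant _ _)); last 2 first.
- exact: iter_modes_finite.
- exact: subst_x1_fg_finite cN cfin.
rewrite (subst_g2_qseries g0 g1) (subst_g2_fg g0 g1 hF cN cfin) subst_g2_comp subst_g2_iter.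
have [U FgE] := fg_twist_dvd g0 g1 hF.
have -> : subst_both g0 (F ^+ l) = fg_subst2 F g ^+ l.
  by rewrite (fg_subst2E g0); exact: rmorphXn.
have -> : fg_twist F g ^+ l = U ^+ l * fg_subst2 F g ^+ l.
  by rewrite -exprMn; congr (_ ^+ l).
rewrite qseriesM => e'.
rewrite -mul2A; [|exact: qseries_quadrant|exact: qseries_quadrant|].
  rewrite -mul2A; [|exact: qseries_quadrant|exact: qseries_quadrant|exact: ifin'].
  by congr (mul2 _ _); exact: e'.
exact: subst_x1_fg_finite Fg0 cN' cfin'.
Qed.

Lemma vo_twistP : nonlocal_vertex_algebra (fg_twist F g) Yg one.
Proof.
have YgE v w n : Yg v w n = \sum_(m \in [set: int]) gamma g m n *: Y v w m by [].
split.
- exact: vo_twist_linear.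
- exact: vo_twist_trunc.
- move=> v; apply/funext => n; rewrite YgE (nva_vacuum hV).
  rewrite (@fsum_one _ _ 0).
    rewrite gamma0 /const_series eqxx.
    by case: eqP; rewrite ?scale1r ?scale0r.
  by move=> m /negPf m0; rewrite /const_series m0 scaler0.
- move=> v n n0; rewrite YgE; apply: fsbig1 => m _.
  have [m0|m0] := ltP m 0; first by rewrite (nva_creation hV) // scaler0.
  by rewrite (gamma_lt g0 g1) ?scale0r //; exact: lt_le_trans n0 m0.
- move=> v; rewrite YgE (@fsum_one _ _ 0).
    by rewrite (gamma_diag g0 g1) scale1r (nva_creation0 hV).
  (* For m < 0 the coefficient of x^m in Y(v, x)1 is 0, and for m > 0 the series g(x)^m has no
     constant term. *)
  move=> m; case: (ltgtP m 0) => // m0 _.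
    by rewrite (nva_creation hV) // scaler0.
  by rewrite (gamma_lt g0 g1) // scale0r.
exact: vo_twist_assoc.
Qed.

End VertexTwist.

Theorem theorem4p6 (R : realType)
    (F : {fps {fps R[i]}}) (phi : {fps {laurent R[i]}}) (g : {fps R[i]})
    (V : lmodType R[i]) (Y : V -> V -> int -> V) (one : V)
    (W : lmodType R[i]) (YW : V -> W -> int -> W)
    (hF : formal_group F) (hphi : associate F phi)
    (hg0 : g 0%N = 0) (hg1 : g 1%N = 1)
    (hV : nonlocal_vertex_algebra F Y one)
    (hYW : bilinear_modes YW) :
  [/\ formal_group (fg_twist F g),
      associate (fg_twist F g) (associate_twist phi g),
      nonlocal_vertex_algebra (fg_twist F g) (vo_twist Y g) one,
      coordinated_module phi Y one YW <->
      coordinated_module (associate_twist phi g) (vo_twist Y g) one YW &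
      coordinated_quasi_module phi Y one YW <->
      coordinated_quasi_module (associate_twist phi g) (vo_twist Y g) one YW].
Proof.
split.
- exact: fg_twistP.
- exact: associate_twistP.
- exact: vo_twistP.
- exact: (coordinated_module_twist hg0 hg1 (associatex0 hphi) one YW (nva_trunc hV)).
exact: (coordinated_module_twist hg0 hg1 (associatex0 hphi) one YW (nva_trunc hV)).
Qed.
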